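(* Let $\sigma>0$, $\alpha>0$, let $f:\mathcal{X}\times\mathcal{Y}\to\mathbb{R}$ be bounded, and let $F(\nu,\mu)=\int_{\mathcal{Y}}\int_{\mathcal{X}}f(x,y)\nu(\mathrm{d}x)\mu(\mathrm{d}y)$ for $(\nu,\mu)\in\mathcal{P}(\mathcal{X})\times\mathcal{P}(\mathcal{Y})$. Assume that $F$ admits first and second order flat derivatives such that: (i) there exist $C_\nu,C_\mu>0$ with $\left|\frac{\delta F}{\delta\nu}(\nu,\mu,x)\right|\le C_\nu$ and $\left|\frac{\delta F}{\delta\mu}(\nu,\mu,y)\right|\le C_\mu$ for all $(\nu,\mu)\in\mathcal{P}(\mathcal{X})\times\mathcal{P}(\mathcal{Y})$ and $(x,y)\in\mathcal{X}\times\mathcal{Y}$; (ii) there exist $C_{\nu,\nu},C_{\mu,\mu},C_{\nu,\mu},C_{\mu,\nu}>0$ with $\left|\frac{\delta^2F}{\delta\nu^2}(\nu,\mu,x,x')\right|\le C_{\nu,\nu}$, $\left|\frac{\delta^2F}{\delta\mu^2}(\nu,\mu,y,y')\right|\le C_{\mu,\mu}$, $\left|\frac{\delta^2F}{\delta\nu\delta\mu}(\nu,\mu,y,x)\right|\le C_{\nu,\mu}$, $\left|\frac{\delta^2F}{\delta\mu\delta\nu}(\nu,\mu,x,y)\right|\le C_{\mu,\nu}$ for all $(\nu,\mu)\in\mathcal{P}(\mathcal{X})\times\mathcal{P}(\mathcal{Y})$ and $(x,y),(x',y')\in\mathcal{X}\times\mathcal{Y}$. Let $(\nu_0,\mu_0)\in\mathcal{P}_{\mathrm{ac}}(\mathcal{X})\times\mathcal{P}_{\mathrm{ac}}(\mathcal{Y})$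 with $\operatorname{NI}(\nu_0,\mu_0)<\infty$, and let $(\nu_t,\mu_t)_{t\ge0}$ be the mean-field best response (MF-BR) flow started at $(\nu_0,\mu_0)$. Then, for all $t\ge0$, $$\operatorname{NI}(\nu_t,\mu_t)\le e^{-\alpha t}\operatorname{NI}(\nu_0,\mu_0).$$
   Context: Setting. $\mathcal{X},\mathcal{Y}\subseteq\mathbb{R}^d$; $U^\pi:\mathcal{X}\to\mathbb{R}$ and $U^\rho:\mathcal{Y}\to\mathbb{R}$ are measurable with $\int_{\mathcal{X}}e^{-U^\pi(x)}\mathrm{d}x=\int_{\mathcal{Y}}e^{-U^\rho(y)}\mathrm{d}y=1$; $\pi(x)=e^{-U^\pi(x)}$, $\rho(y)=e^{-U^\rho(y)}$. $\mathcal{P}(\mathcal{Z})$ is the set of probability measures on $\mathcal{Z}$ and $\mathcal{P}_{\mathrm{ac}}(\mathcal{Z})$ the subset of those absolutely continuous with respect to Lebesgue measure; a measure and its density are denoted by the same symbol. $\operatorname{D_{KL}}(m|m')=\int\log\left(\frac{m(x)}{m'(x)}\right)m(x)\,\mathrm{d}x$ is the relative entropy ($+\infty$ if $m$ is not absolutely continuous with respect to $m'$). Flat derivatives. For $\mathcal{M}\subseteq\mathbb{R}^d$, $G:\mathcal{P}(\mathcal{M})\to\mathbb{R}$ admits a first order flat derivative if there is $\frac{\delta G}{\delta m}:\mathcal{P}(\mathcal{M})\times\mathcal{M}\to\mathbb{R}$, jointly continuous (weak topology on $\mathcal{P}(\mathcal{M})$), such that for each $m$ the function $\frac{\delta G}{\delta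 m}(m,\cdot)$ is bounded and, for all $m,m'$, $G(m')-G(m)=\int_0^1\int_{\mathcal{M}}\frac{\delta G}{\delta m}(m+\varepsilon(m'-m),x)(m'-m)(\mathrm{d}x)\mathrm{d}\varepsilon$; it is normalized by $\int_{\mathcal{M}}\frac{\delta G}{\delta m}(m,x)m(\mathrm{d}x)=0$. For $F$ on $\mathcal{P}(\mathcal{X})\times\mathcal{P}(\mathcal{Y})$, $\frac{\delta F}{\delta\nu}(\nu,\mu,x)$ and $\frac{\delta F}{\delta\mu}(\nu,\mu,y)$ are the flat derivatives in the first and second argument. Second order flat derivatives are flat derivatives of first order ones with the point fixed: $\frac{\delta^2F}{\delta\nu^2}(\nu,\mu,x,\cdot)$ and $\frac{\delta^2F}{\delta\mu\delta\nu}(\nu,\mu,x,\cdot)$ are the flat derivatives in $\nu$, resp. $\mu$, of $\frac{\delta F}{\delta\nu}(\nu,\mu,x)$; $\frac{\delta^2F}{\delta\mu^2}(\nu,\mu,y,\cdot)$ and $\frac{\delta^2F}{\delta\nu\delta\mu}(\nu,\mu,y,\cdot)$ are those in $\mu$, resp. $\nu$, of $\frac{\delta F}{\delta\mu}(\nu,\mu,y)$. NI error. $V^\sigma(\nu,\mu)=F(\nu,\mu)+\frac{\sigma^2}{2}(\operatorname{D_{KL}}(\nu|\pi)-\operatorname{D_{KL}}(\mu|\rho))$ and $\operatorname{NI}(\nu,\mu)=\max_{\mu'\in\mathcal{P}(\mathcal{Y})}V^\sigma(\nu,\mu')-\min_{\nu'\in\mathcal{P}(\mathcal{X})}V^\sigma(\nu',\mu)$.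 Best responses. $\Psi_\sigma(\nu,\mu)$ and $\Phi_\sigma(\nu,\mu)$ are the probability measures on $\mathcal{X}$, $\mathcal{Y}$ with densities $$\Psi_\sigma(\nu,\mu)(x)=\tfrac{1}{Z(\nu,\mu)}\exp\left(-\tfrac{2}{\sigma^2}\tfrac{\delta F}{\delta\nu}(\nu,\mu,x)-U^\pi(x)\right),\quad\Phi_\sigma(\nu,\mu)(y)=\tfrac{1}{Z'(\nu,\mu)}\exp\left(\tfrac{2}{\sigma^2}\tfrac{\delta F}{\delta\mu}(\nu,\mu,y)-U^\rho(y)\right),$$ where $Z,Z'$ are normalizing constants. MF-BR flow. With learning rate $\alpha>0$, it is the unique flow $(\nu_t,\mu_t)_{t\ge0}$ in $\mathcal{P}_{\mathrm{ac}}(\mathcal{X})\times\mathcal{P}_{\mathrm{ac}}(\mathcal{Y})$ with the given initial condition satisfying, for $t\ge0$, $\mathrm{d}\nu_t(x)=\alpha(\Psi_\sigma(\nu_t,\mu_t)(x)-\nu_t(x))\mathrm{d}t$ and $\mathrm{d}\mu_t(y)=\alpha(\Phi_\sigma(\nu_t,\mu_t)(y)-\mu_t(y))\mathrm{d}t$ (existence and uniqueness hold under (i) and (ii)). *)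

(* Defs.v *)
From HB Require Import structures.
From mathcomp Require Import all_boot all_order all_algebra.
From mathcomp Require Import all_classical all_reals all_analysis.
From mathcomp Require Import measurable_realfun.

Set Implicit Arguments.
Unset Strict Implicit.
Unset Printing Implicit Defensive.

Import Order.TTheory GRing.Theory Num.Theory.
Import numFieldNormedType.Exports.

Local Open Scope classical_set_scope.
Local Open Scope ring_scope.

Definition borel_rV_display : measure_display.
Proof. exact: default_measure_display. Qed.

HB.instance Definition _ (R : realType) (n : nat) :=
  @isMeasurable.Build borel_rV_display 'rV[R]_n
    <<s (@open 'rV[R]_n) >> (@sigma_algebra0 _ setT _)
    (@sigma_algebraC _ _) (@sigma_algebra_bigcup _ setT _).

Section borel_rV.
Context {R : realType} {n : nat}.

Lemma measurable_rVE :
  (measurable : set (set 'rV[R]_n)) = <<s (@open 'rV[R]_n) >>.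
Proof. by []. Qed.

Lemma open_measurable_rV (U : set 'rV[R]_n) : open U -> measurable U.
Proof. by move=> oU; apply: sub_gen_smallest. Qed.

Lemma measurable_coord (i : 'I_n) :
  measurable_fun [set: 'rV[R]_n] (fun v : 'rV[R]_n => v ord0 i).
Proof.
apply: (measurability _ (RGenOpens.measurableE R)) => _ [U [a [b ->]] <-].
rewrite setTI; apply: open_measurable_rV.
apply: open_comp; last exact: interval_open.
by move=> v _; exact: coord_continuous.
Qed.

Lemma measurable_fun_rV d (T : measurableType d) (f : T -> 'rV[R]_n) :
  (forall i, measurable_fun setT (fun x => f x ord0 i)) ->
  measurable_fun setT f.
Proof.
move=> mf.
apply: (@measurability _ _ _ _ _ _ (@open 'rV[R]_n)) => // _ [U oU <-].
rewrite setTI.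
pose rbox (q : ('rV[rat]_n * rat)%type) : set 'rV[R]_n :=
  [set v | forall i, `|ratr (q.1 ord0 i) - v ord0 i| < ratr q.2].
have -> : f @^-1` U =
    \bigcup_(q in [set q | rbox q `<=` U]) (f @^-1` rbox q).
  apply/seteqP; split=> [x Ux|x [q qU] /qU//].
  have /nbhs_ballP[e /= e0 eU] : nbhs (f x) U by exact: open_nbhs_nbhs.
  have [r /itvP re] : exists r : rat, (ratr r : R) \in `]0, (e / 2)[.
    by apply: rat_in_itvoo; rewrite divr_gt0.
  have r0 : 0 < ratr r :> R by rewrite re.
  have qP i : exists q : rat,
      (ratr q : R) \in `](f x ord0 i - ratr r), (f x ord0 i + ratr r)[.
    by apply: rat_in_itvoo; rewrite ltrBlDr -addrA ltrDl addr_gt0.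
  pose q := \row_i sval (cid (qP i)).
  have qr i : `|ratr (q ord0 i) - f x ord0 i| < ratr r.
    by rewrite mxE; case: cid => /= s /itvP sE; rewrite ltr_distl !sE.
  exists (q, r) => //= v /= vq; apply: eU; split => // j i.
  rewrite [j]ord1 /ball/= (le_lt_trans (ler_distD (ratr (q ord0 i)) _ _))//.
  rewrite [ltRHS]splitr ltrD//.
    by rewrite distrC (lt_le_trans (qr i))// ltW// re.
  by rewrite (lt_le_trans (vq i))// ltW// re.
rewrite bigcup_mkcond; apply: countable_bigcupT_measurable => // q.
case: ifPn => // _.
have -> : f @^-1` rbox q = \bigcap_(i in [set: 'I_n])
    ((fun x => f x ord0 i) @^-1` `](ratr (q.1 ord0 i) - ratr q.2),
                                   (ratr (q.1 ord0 i) + ratr q.2)[%classic).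
  apply/seteqP; split=> [x fx i _|x fx i] /=.
    by rewrite in_itv/= -ltr_distl distrC; exact: fx.
  by have := fx i I; rewrite /= in_itv/= -ltr_distl distrC.
apply: fin_bigcap_measurable => // i _.
by rewrite -[X in measurable X]setTI; exact: mf.
Qed.

End borel_rV.

Section cons_rV.
Context {R : realType} {n : nat}.

Definition cons_rV (xv : R * 'rV[R]_n) : 'rV[R]_n.+1 :=
  \row_i oapp (xv.2 ord0) xv.1 (unlift ord0 i).

Definition uncons_rV (v : 'rV[R]_n.+1) : R * 'rV[R]_n :=
  (v ord0 ord0, \row_i v ord0 (lift ord0 i)).

Lemma cons_rVK : cancel cons_rV uncons_rV.
Proof.
case=> x v; rewrite /uncons_rV mxE unlift_none; congr pair.
by apply/rowP => i; rewrite !mxE liftK.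
Qed.

Lemma measurable_cons_rV : measurable_fun setT cons_rV.
Proof.
apply: measurable_fun_rV => i.
case: (unliftP ord0 i) => [j|] ->.
  under eq_fun do rewrite mxE liftK/=.
  exact: (measurableT_comp (measurable_coord j) measurable_snd).
by under eq_fun do rewrite mxE unlift_none/=; exact: measurable_fst.
Qed.

Lemma measurable_uncons_rV : measurable_fun setT uncons_rV.
Proof.
apply: measurable_fun_pair; first exact: measurable_coord.
apply: measurable_fun_rV => i; under eq_fun do rewrite mxE.
exact: measurable_coord.
Qed.

Variable m : {sigma_finite_measure set 'rV[R]_n -> \bar R}.

Definition cons_measure : set 'rV[R]_n.+1 -> \bar R :=
  pushforward (@lebesgue_measure R \x m)%E cons_rV.

Let mpre A : measurable A -> measurable (cons_rV @^-1` A).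
Proof.
by move=> mA; rewrite -[X in measurable X]setTI; exact: measurable_cons_rV.
Qed.

Let cons_measure0 : cons_measure set0 = 0%E.
Proof. by rewrite /cons_measure /pushforward preimage_set0 measure0. Qed.

Let cons_measure_ge0 A : (0 <= cons_measure A)%E.
Proof. by rewrite /cons_measure /pushforward measure_ge0. Qed.

Let cons_measure_sigma_additive : semi_sigma_additive cons_measure.
Proof.
move=> F mF tF mUF; rewrite /cons_measure /pushforward preimage_bigcup.
apply: measure_semi_sigma_additive => [k||].
- exact: mpre.
- apply/trivIsetP => /= i j _ _ ij; rewrite -preimage_setI.
  by move/trivIsetP : tF => /(_ _ _ _ _ ij) ->//; rewrite preimage_set0.
- by rewrite -preimage_bigcup; exact: mpre.
Qed.

HB.instance Definition _ := isMeasure.Build _ _ _ cons_measure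
  cons_measure0 cons_measure_ge0 cons_measure_sigma_additive.

Let cons_measure_sigma_finite : sigma_finite setT cons_measure.
Proof.
have /sigma_finiteP[F [TF ndF Foo]] := sigma_finiteT (@lebesgue_measure R).
have /sigma_finiteP[G [TG ndG Goo]] := sigma_finiteT m.
exists (fun k => uncons_rV @^-1` (F k `*` G k)).
  rewrite -preimage_bigcup (_ : \bigcup_k _ = setT) ?preimage_setT//.
  apply/seteqP; split=> // -[x v] _.
  have [i _ Fix] : (\bigcup_k F k) x by rewrite -TF.
  have [j _ Gjv] : (\bigcup_k G k) v by rewrite -TG.
  exists (maxn i j) => //; split => /=.
    by move: x Fix; exact/subsetPset/ndF/leq_maxl.
  by move: v Gjv; exact/subsetPset/ndG/leq_maxr.
move=> k; have [mF Fk] := Foo k; have [mG Gk] := Goo k; split.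
  by rewrite -[X in measurable X]setTI; apply: measurable_uncons_rV => //;
    exact: measurableX.
rewrite /cons_measure /pushforward -comp_preimage.
rewrite (_ : _ \o _ = id) ?preimage_id; last by apply/funext; exact: cons_rVK.
by rewrite product_measure1E// lte_mul_pinfty// ge0_fin_numE.
Qed.

HB.instance Definition _ :=
  Measure_isSigmaFinite.Build _ _ _ cons_measure cons_measure_sigma_finite.

End cons_rV.

(* On [R^0], a single point, the Lebesgue measure is the unit mass. *)
Fixpoint lebesgue_rV (R : realType) (n : nat) :
    {sigma_finite_measure set 'rV[R]_n -> \bar R} :=
  match n with
  | 0%N => @dirac _ 'rV[R]_0 0 R
  | n'.+1 => cons_measure (lebesgue_rV R n')
  end.

Lemma lebesgue_rV_box (R : realType) (n : nat) (A : 'I_n -> set R) :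
  (forall i, measurable (A i)) ->
  lebesgue_rV R n [set v : 'rV[R]_n | forall i, A i (v ord0 i)] =
  (\prod_(i < n) lebesgue_measure (A i))%E.
Proof.
elim: n A => [|n IHn] A mA.
  by rewrite big_ord0 /= diracE mem_set//= => -[].
pose B := [set v : 'rV[R]_n | forall i, A (lift ord0 i) (v ord0 i)].
have mB : measurable B.
  have -> : B = \bigcap_(i in [set: 'I_n])
      ((fun v : 'rV[R]_n => v ord0 i) @^-1` A (lift ord0 i)).
    by apply/seteqP; split=> v vA i; [move=> _|]; exact: vA.
  apply: fin_bigcap_measurable => // i _.
  by rewrite -[X in measurable X]setTI; exact: measurable_coord.
rewrite big_ord_recl -(IHn (fun i => A (lift ord0 i)))//.
transitivity ((@lebesgue_measure R \x lebesgue_rV R n)%E (A ord0 `*` B)).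
  2: rewrite product_measure1E; [by rewrite /B|exact: mA|exact: mB].
rewrite /= /cons_measure /pushforward; congr (_ _).
apply/seteqP; split=> [[x v] /= xvA|[x v] /= [xA vA] i].
  split=> [|i]; first by have := xvA ord0; rewrite mxE unlift_none.
  by have := xvA (lift ord0 i); rewrite mxE liftK.
by case: (unliftP ord0 i) => [j|] ->; rewrite mxE ?liftK ?unlift_none//=.
Qed.

Section mixture.
Context d (T : measurableType d) (R : realType) (e : R) (m m' : probability T R).

(* [(1 - e) m + e m'] when [0 <= e <= 1]; the junk value [m] otherwise. *)
Definition mixture (A : set T) : \bar R :=
  if 0 <= e <= 1 then ((1 - e)%:E * m A + e%:E * m' A)%E else m A.

Let mixture0 : mixture set0 = 0%E.
Proof. by rewrite /mixture; case: ifP; rewrite !measure0 ?mule0 ?adde0. Qed.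

Let mixture_ge0 A : (0 <= mixture A)%E.
Proof.
rewrite /mixture; case: ifPn => // /andP[e0 e1].
by apply: adde_ge0; apply: mule_ge0 => //; rewrite lee_fin// subr_ge0.
Qed.

Let mixture_sigma_additive : semi_sigma_additive mixture.
Proof.
have [/andP[e0 e1]|e01] := boolP (0 <= e <= 1); last first.
  rewrite (_ : mixture = m); first exact: measure_semi_sigma_additive.
  by apply/funext => A; rewrite /mixture (negbTE e01).
have e1' : 0 <= 1 - e by rewrite subr_ge0.
pose me := measure_add (mscale (NngNum e1') m) (mscale (NngNum e0) m').
rewrite (_ : mixture = me); first exact: measure_semi_sigma_additive.
by apply/funext => A; rewrite /mixture e0 e1 /me measure_addE.
Qed.

HB.instance Definition _ := isMeasure.Build _ _ _ mixture
  mixture0 mixture_ge0 mixture_sigma_additive.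

Let mixture_setT : mixture setT = 1%E.
Proof.
rewrite /mixture; case: ifP => _; rewrite !probability_setT//.
by rewrite !mule1 -EFinD subrK.
Qed.

HB.instance Definition _ :=
  Measure_isProbability.Build _ _ _ mixture mixture_setT.

End mixture.

Section probabilities_on.
Context {R : realType} {d : nat}.
Implicit Types (M : set 'rV[R]_d) (m : probability 'rV[R]_d R).

(* Probability measures on [M] are represented by the probability measures on
   [R^d] concentrated on [M]. *)
Definition probs M : set (probability 'rV[R]_d R) := [set m | m M = 1%E].

Definition probs_ac M : set (probability 'rV[R]_d R) :=
  [set m | probs M m /\ m `<< lebesgue_rV R d].

Definition bounded_continuous M : Type :=
  {phi : 'rV[R]_d -> R |
    {within M, continuous phi} /\ [bounded phi x | x in M]}.

HB.instance Definition _ M := gen_eqMixin (bounded_continuous M).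
HB.instance Definition _ M := gen_choiceMixin (bounded_continuous M).

(* The type of probability measures, with the coarsest topology making
   [m |-> \int_M phi dm] continuous for all [phi] bounded continuous on [M];
   on [probs M] this is the topology of weak convergence. *)
Definition weak_probs M : Type :=
  initial_topology (fun (m : probability 'rV[R]_d R) =>
    (fun phi : bounded_continuous M => \int[m]_(x in M) sval phi x)
    : {ptws bounded_continuous M -> R}).

HB.instance Definition _ M := Topological.on (weak_probs M).

(* [D] is the normalized flat derivative of [G] on [probs M]. Integrability of
   the integrand in [e] makes the last integral meaningful: a divergent
   [Rintegral] would take the value 0. It is automatic if [D] is bounded on
   [probs M `*` M]. *)
Definition is_flat_derivative M (G : probability 'rV[R]_d R -> R)
    (D : probability 'rV[R]_d R -> 'rV[R]_d -> R) : Prop :=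
  [/\ {within [set z : weak_probs M * 'rV[R]_d | probs M z.1 /\ M z.2],
        continuous (fun z : weak_probs M * 'rV[R]_d => D z.1 z.2)},
      forall m, probs M m -> [bounded D m x | x in M],
      forall m m', probs M m -> probs M m' ->
        let h := fun e : R => \int[m']_(x in M) D (mixture e m m') x
                            - \int[m]_(x in M) D (mixture e m m') x in
        lebesgue_measure.-integrable `[0, 1] (EFin \o h) /\
        G m' - G m = \int[lebesgue_measure]_(e in `[0, 1]) h e
    & forall m, probs M m -> \int[m]_(x in M) D m x = 0].

(* [p] is a density on [M], with respect to the Lebesgue measure, of a measure
    [m] concentrated on [M]. *)
Definition is_density M m (p : 'rV[R]_d -> R) : Prop :=
  [/\ measurable_fun M p, forall x, M x -> 0 <= p x
    & forall A, measurable A ->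
        m A = (\int[lebesgue_rV R d]_(x in A `&` M) (p x)%:E)%E].

Definition density m (x : 'rV[R]_d) : R :=
  fine (Radon_Nikodym (charge_of_finite_measure m) (lebesgue_rV R d) x).

(* Relative entropy of [m] with respect to the measure on [M] with density
    [q]. *)
Definition KL M m (q : 'rV[R]_d -> R) : \bar R :=
  if `[< m `<< (fun A : set 'rV[R]_d =>
           (\int[lebesgue_rV R d]_(x in A `&` M) (q x)%:E)%E) >]
  then (\int[lebesgue_rV R d]_(x in M)
          (ln (density m x / q x) * density m x)%:E)%E
  else +oo%E.

End probabilities_on.

Section game.
Context {R : realType} {d : nat}.
Local Notation E := 'rV[R]_d.
Local Notation P := (probability 'rV[R]_d R).
Variables (X Y : set E) (Upi Urho : E -> R) (sigma : R).

Definition payoff (f : E -> E -> R) (nu mu : P) : R :=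
  \int[mu]_(y in Y) \int[nu]_(x in X) f x y.

Section NI_error.
Variable F : P -> P -> R.

(* When both relative entropies are infinite the difference takes the value
   [-oo]; this choice affects neither the supremum nor the infimum in [NI],
   which are then reached, with values [+oo] and [-oo], at the reference
   measures. *)
Definition V (nu mu : P) : \bar R :=
  ((F nu mu)%:E + (sigma ^+ 2 / 2)%:E *
    (KL X nu (fun x => expR (- Upi x)) - KL Y mu (fun y => expR (- Urho y))))%E.

(* The maximum and minimum over probability measures are written as supremum
   and infimum in the extended reals. *)
Definition NI (nu mu : P) : \bar R :=
  (ereal_sup [set V nu mu' | mu' in probs Y]
   - ereal_inf [set V nu' mu | nu' in probs X])%E.

End NI_error.

Section flow.
(* Intended: the flat derivatives of the payoff in its first and second
   argument. *)
Variables dFnu dFmu : P -> P -> E -> R.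

Definition Psi (nu mu : P) (x : E) : R :=
  let g x := expR (- (2 / sigma ^+ 2) * dFnu nu mu x - Upi x) in
  g x / \int[lebesgue_rV R d]_(z in X) g z.

Definition Phi (nu mu : P) (y : E) : R :=
  let g y := expR (2 / sigma ^+ 2 * dFmu nu mu y - Urho y) in
  g y / \int[lebesgue_rV R d]_(z in Y) g z.

(* [u] is differentiable at [t] relatively to [[0, +oo[], with derivative [l]
    (a right derivative when [t = 0]). *)
Definition is_derive_ge0 (u : R -> R) (t l : R) : Prop :=
  (u s - u t) / (s - t) @[s --> within `[0, +oo[ t^'] --> l.

Definition is_MFBR_flow (alpha : R) (nu0 mu0 : P) (nu mu : R -> P) : Prop :=
  [/\ nu 0 = nu0 /\ mu 0 = mu0,
      forall t, 0 <= t -> probs_ac X (nu t) /\ probs_ac Y (mu t)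
    & exists p q : R -> E -> R,
      [/\ forall t, 0 <= t -> is_density X (nu t) (p t) /\
                              is_density Y (mu t) (q t),
          forall t x, 0 <= t -> X x ->
            is_derive_ge0 (p^~ x) t (alpha * (Psi (nu t) (mu t) x - p t x))
        & forall t y, 0 <= t -> Y y ->
            is_derive_ge0 (q^~ y) t (alpha * (Phi (nu t) (mu t) y - q t y))]].

End flow.
End game.

(* Main.v *)
(**
Since [f] is bilinear, the flat derivative in [nu] is the potential of [mu] up to
a constant, so the best responses are Gibbs measures of the fields
[G = -+ (2 / sigma ^ 2) \int f], and by Gibbs' variational principle
[NI = sigma ^ 2 / 2 * (S_X + S_Y)] with [S = KL + ln Z(G)] for each player.
Fix [s < t] and [c = 1 - exp (- alpha (t - s))]. Comparison in the pointwise
linear ODE gives [p_t = (1 - c) p_s + c (Psi_t + O(t - s))] and hence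
[G_t = (1 - c) G_s + c (H_t + O(t - s))], where [H_t] is the field created by the
best response of the opponent. Convexity of [p ln (p / q)] for [KL], and the
variational principle for [ln Z], then yield
[S_t <= (1 - c) S_s + c \int H_t dPsi_t + c O(t - s)]. The terms [\int H_t dPsi_t]
of the two players are opposite, the game being zero-sum. Iterating over a uniform
subdivision of [[0, t]] the errors vanish in the limit. In this way no regularity
in time is needed beyond the pointwise ODE.
*)
From HB Require Import structures.
Require Import Defs.
From mathcomp Require Import all_boot all_order all_algebra.
From mathcomp Require Import all_classical all_reals all_analysis.
From mathcomp Require Import measurable_realfun ring lra.

Set Implicit Arguments.
Unset Strict Implicit.
Unset Printing Implicit Defensive.

Import Order.TTheory GRing.Theory Num.Theory.
Import numFieldNormedType.Exports.

Local Open Scope classical_set_scope.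
Local Open Scope ring_scope.

(** * Scalar inequalities *)

(** The ratio [p_s / q] may vanish or be unbounded in space, so [ln (p_s / q)] admits no uniform
    bound and the entropy cannot be perturbed around [p_s]. The increment is therefore split as
    [p_t = (1 - c) p_s + c w]: the averaged target [w] inherits from the Gibbs densities the bounds
    [exp (-2 k) q <= w <= exp (2 k) q], where [k] bounds the fields. Only [w] is perturbed, which is
    why every error carries the weight [c]; such errors add up to the order of the step length.

    Regularity of the fields in time comes from the same bounds in two stages, which avoids a
    circular argument. The bounds on the Gibbs densities alone, whatever the time dependence of the
    fields, make the measures and hence the fields Lipschitz in time; the best responses are then
    Lipschitz as well and can be frozen over a step.

    Finiteness of both entropies is known at time 0 only, through the finiteness of [NI], and has to
    be propagated together with the inequality. *)

Section scalar_inequalities.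
Context {R : realType}.
Implicit Types a b c q w x y t : R.

Lemma ln_le_subr1 x : 0 < x -> ln x <= x - 1.
Proof. by move=> x0; rewrite -[X in ln X](subrKC 1) le_ln1Dx// ltrBrDl subrr. Qed.

(* The tangent at [c] of the convex function [b |-> b ln (b / q)]. *)
Lemma entropy_tangent b c q : 0 <= b -> 0 < c -> 0 < q ->
  ln (c / q) * b + b - c <= ln (b / q) * b.
Proof.
rewrite le_eqVlt => /predU1P[<-|b0] c0 q0; first by rewrite !mulr0 !add0r oppr_le0 ltW.
have := ln_le_subr1 (divr_gt0 c0 b0).
rewrite !ln_div ?posrE// => h.
have : (ln c - ln b) * b <= (c / b - 1) * b by rewrite ler_pM2r.
rewrite mulrBl mulrBl divfK ?gt_eqF// mul1r => h'.
lra.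
Qed.

(** Both tangents are taken at the mixture itself; weighted by [1 - c] and [c], their affine parts
    cancel. Only the mixture has to be positive, so either density may vanish. *)
Lemma entropy_convex a b c q : 0 <= a -> 0 <= b -> 0 < q -> 0 <= c <= 1 ->
  0 < (1 - c) * a + c * b ->
  ln (((1 - c) * a + c * b) / q) * ((1 - c) * a + c * b) <=
  (1 - c) * (ln (a / q) * a) + c * (ln (b / q) * b).
Proof.
move=> a0 b0 q0 /andP[c0 c1] u0; set u := _ + _ in u0 *.
have := entropy_tangent a0 u0 q0; have := entropy_tangent b0 u0 q0.
set l := ln (u / q) => hb ha.
have {}hb : c * (l * b + b - u) <= c * (ln (b / q) * b) by rewrite ler_wpM2l.
have {}ha : (1 - c) * (l * a + a - u) <= (1 - c) * (ln (a / q) * a).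
  by rewrite ler_wpM2l// subr_ge0.
apply: (le_trans _ (lerD ha hb)).
rewrite [leRHS](_ : _ = l * u + (u - u))/u; last by ring.
by rewrite subrr addr0.
Qed.

Lemma ln_ratio_bound w q k : 0 < q ->
  expR (- k) * q <= w <= expR k * q -> `|ln (w / q)| <= k.
Proof.
move=> q0 /andP[w1 w2].
have w0 : 0 < w by rewrite (lt_le_trans _ w1)// mulr_gt0// expR_gt0.
have wq0 : 0 < w / q by rewrite divr_gt0.
rewrite ler_norml -[X in X <= _](expRK (- k)) -[X in _ && (_ <= X)](expRK k).
by rewrite !ler_ln ?posrE ?expR_gt0// ler_pdivlMr// w1 ler_pdivrMr.
Qed.

(** The tangent is taken at [w], whose logarithm relative to [q] is at most [k] in absolute value;
    [y] may vanish. The factor [1 + k] bounds the slope [1 + ln (w / q)]. *)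
Lemma entropy_perturb y w q k e : 0 < q -> 0 <= y -> 0 <= k ->
  expR (- k) * q <= w <= expR k * q -> `|w - y| <= e * q ->
  ln (w / q) * w <= ln (y / q) * y + (1 + k) * e * q.
Proof.
move=> q0 y0 k0 wk wy.
have w0 : 0 < w by case/andP: wk => + _; apply: lt_le_trans; rewrite mulr_gt0// expR_gt0.
have lk := ln_ratio_bound q0 wk.
have := entropy_tangent y0 w0 q0; set l := ln (w / q) in lk * => h.
have : (1 + l) * (w - y) <= (1 + k) * (e * q).
  apply: (le_trans (ler_norm _)); rewrite normrM ler_pM//.
  by rewrite (le_trans (ler_normD _ _))// normr1 lerD2l.
lra.
Qed.

(* [u] is one step of the relaxation towards [y], up to the error [e]. *)
Lemma entropy_step a u y q k e c : 0 < q -> 0 <= a -> 0 <= y -> 0 <= k ->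
  0 < c <= 1 ->
  (1 - c) * a + c * (expR (- k) * q) <= u <= (1 - c) * a + c * (expR k * q) ->
  `|u - (1 - c) * a - c * y| <= c * (e * q) ->
  ln (u / q) * u <=
  (1 - c) * (ln (a / q) * a) + c * (ln (y / q) * y) + c * ((1 + k) * e) * q.
Proof.
move=> q0 a0 y0 k0 /andP[c0 c1] /andP[u1 u2] uy.
(* Solving for the averaged target charges the whole error to [w], which is comparable to [q], and
   leaves [a] exact. *)
pose w := (u - (1 - c) * a) / c.
have uE : u = (1 - c) * a + c * w by rewrite /w mulrCA divff ?gt_eqF// mulr1 addrC subrK.
have wk : expR (- k) * q <= w <= expR k * q.
  by move: u1 u2; rewrite uE !lerD2l !ler_pM2l// => -> ->.
have w0 : 0 < w by case/andP: wk => + _; apply: lt_le_trans; rewrite mulr_gt0// expR_gt0.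
have wy : `|w - y| <= e * q.
  move: uy; rewrite uE (_ : _ - _ - _ = c * (w - y)); last by ring.
  by rewrite normrM gtr0_norm// ler_pM2l.
have u0 : 0 < u.
  by rewrite uE; apply: ltr_wpDl; [rewrite mulr_ge0// subr_ge0|exact: mulr_gt0].
rewrite uE in u0 *; apply: (le_trans (entropy_convex a0 (ltW w0) q0 _ u0)).
  by rewrite (ltW c0).
have := entropy_perturb q0 y0 k0 wk wy; rewrite -(ler_pM2l c0) mulrDr => h.
by rewrite -addrA lerD2l (le_trans h)// !mulrA.
Qed.

Lemma expR_lipschitz x k : `|x| <= k -> `|expR x - 1| <= expR k * `|x|.
Proof.
move=> xk; have xk' := ler_normlW xk.
have h1 := expR_ge1Dx x.
have h2 : 1 - x <= expR (- x) by exact: expR_ge1Dx.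
have h3 : expR x - 1 <= expR x * x.
  have : expR x * (1 - x) <= expR x * expR (- x) by rewrite ler_pM2l ?expR_gt0.
  by rewrite expRxMexpNx_1; lra.
have k0 : 0 <= k := le_trans (normr_ge0 _) xk.
have ek : 1 <= expR k by rewrite (le_trans _ (expR_ge1Dx k))// lerDl.
rewrite ler_norml; apply/andP; split.
  have : `|x| <= expR k * `|x| by rewrite ler_peMl.
  have := ler_norm (- x); rewrite normrN; lra.
apply: (le_trans h3); apply: (@le_trans _ _ (expR x * `|x|)).
  by rewrite ler_pM2l ?expR_gt0// ler_norm.
by rewrite ler_wpM2r// ler_expR.
Qed.

End scalar_inequalities.

(** * Iteration of approximate relaxation steps *)

Section relaxation.
Context {R : realType}.

(** The error of a step carries the weight [1 - exp (- alpha h)], complementary to the decay factor.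
    Composing steps is then a convex combination: after [k] steps of length [h] the error is still
    at most [(1 - exp (- alpha h k)) C h], an invariant that does not grow with the number of steps.
    Then [h] tends to 0. *)
Lemma relaxation_decay (alpha C T : R) (S : R -> R) : 0 <= T ->
  (forall s t, 0 <= s -> s < t -> t <= T ->
    S t <= expR (- (alpha * (t - s))) * S s +
           (1 - expR (- (alpha * (t - s)))) * (C * (t - s))) ->
  S T <= expR (- (alpha * T)) * S 0.
Proof.
rewrite le_eqVlt => /predU1P[<- _|T0 step]; first by rewrite mulr0 oppr0 expR0 mul1r.
suff h n : S T <= expR (- (alpha * T)) * S 0 + (1 - expR (- (alpha * T))) * (C * T / n.+1%:R).
  have: (fun n : nat => expR (- (alpha * T)) * S 0 +
      (1 - expR (- (alpha * T))) * (C * T / n.+1%:R)) @ \oo -->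
      expR (- (alpha * T)) * S 0 + (1 - expR (- (alpha * T))) * ((C * T) * 0).
    apply: cvgD; first exact: cvg_cst.
    apply: cvgMr; apply: cvgMr; exact: cvg_harmonic.
  by rewrite !mulr0 addr0 => /cvgr_to_ge; apply; exact: nearW.
have N0 : 0 < n.+1%:R :> R by rewrite ltr0n.
pose h := T / n.+1%:R; have h0 : 0 < h by rewrite divr_gt0.
have hT : h *+ n.+1 = T by rewrite /h -mulr_natr divfK// gt_eqF.
rewrite -[C * _ / _]mulrA -/h -hT.
suff H k : (k <= n.+1)%N -> S (h *+ k) <= expR (- (alpha * (h *+ k))) * S 0 +
    (1 - expR (- (alpha * (h *+ k)))) * (C * h) by exact: H.
elim: k => [|k IHk] kn.
  by rewrite mulr0n !mulr0 oppr0 expR0 subrr !mul0r addr0 mul1r.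
have := step (h *+ k) (h *+ k.+1); rewrite mulrS addrK => /(_ _ _ _) st.
apply: (le_trans (st _ _ _)).
- by rewrite mulrn_wge0// ltW.
- by rewrite ltrDr.
- by rewrite -mulrS -hT ler_wpMn2l// ltW.
have {}IHk := IHk (ltnW kn).
rewrite mulrDr opprD expRD.
set c := expR (- (alpha * h)) in IHk *; set ck := expR _ in IHk *.
have c0 : 0 <= c by exact: expR_ge0.
apply: (le_trans (lerD (ler_wpM2l c0 IHk) (lexx _))).
rewrite le_eqVlt; apply/orP; left; apply/eqP; ring.
Qed.

End relaxation.

(** * Gibbs densities and free energy *)

Section Rintegral_bounds.
Context d (T : measurableType d) (R : realType).
Variables (L : {measure set T -> \bar R}) (D : set T).
Hypothesis mD : measurable D.
Implicit Types f g : T -> R.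

Lemma le_integrableR f g : measurable_fun D f -> L.-integrable D (EFin \o g) ->
  (forall x, D x -> `|f x| <= g x) -> L.-integrable D (EFin \o f).
Proof.
move=> mf ig fg; apply: (le_integrable mD _ _ ig); first exact/measurable_EFinP.
by move=> x Dx /=; rewrite lee_fin (le_trans (fg x Dx))// ler_norm.
Qed.

Lemma ler_norm_Rintegral f g : measurable_fun D f -> L.-integrable D (EFin \o g) ->
  (forall x, D x -> `|f x| <= g x) ->
  `|\int[L]_(x in D) f x| <= \int[L]_(x in D) g x.
Proof.
move=> mf ig fg; have if_ := le_integrableR mf ig fg.
apply: (le_trans (le_normr_Rintegral mD if_)).
by apply: le_Rintegral => //; exact: integrable_norm.
Qed.

Lemma integrable_unit_mass f : measurable_fun D f -> (forall x, D x -> 0 <= f x) ->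
  (\int[L]_(x in D) (f x)%:E = 1)%E -> L.-integrable D (EFin \o f).
Proof.
move=> mf f0 f1; apply/integrableP; split; first exact/measurable_EFinP.
under eq_integral => x /[!inE] Dx do rewrite /= ger0_norm ?f0//.
by rewrite f1 ltry.
Qed.

Lemma integrableDR f g : L.-integrable D (EFin \o f) ->
  L.-integrable D (EFin \o g) -> L.-integrable D (EFin \o (fun x => f x + g x)).
Proof.
move=> if_ ig; apply: (@eq_integrable _ _ _ L D mD ((EFin \o f) \+ (EFin \o g))%E) => //.
exact: integrableD.
Qed.

Lemma integrableZR f (c : R) : L.-integrable D (EFin \o f) ->
  L.-integrable D (EFin \o (fun x => c * f x)).
Proof.
move=> if_; apply: (@eq_integrable _ _ _ L D mD (fun x => c%:E * (EFin \o f) x)%E) => //.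
exact: integrableZl.
Qed.

Lemma Rintegral_lin3 f1 f2 f3 (c1 c2 c3 : R) : L.-integrable D (EFin \o f1) ->
  L.-integrable D (EFin \o f2) -> L.-integrable D (EFin \o f3) ->
  \int[L]_(x in D) (c1 * f1 x + c2 * f2 x + c3 * f3 x) =
  c1 * \int[L]_(x in D) f1 x + c2 * \int[L]_(x in D) f2 x
  + c3 * \int[L]_(x in D) f3 x.
Proof.
move=> i1 i2 i3.
have j1 := integrableZR c1 i1; have j2 := integrableZR c2 i2.
have j3 := integrableZR c3 i3.
rewrite RintegralD//; last exact: integrableDR.
by rewrite RintegralD// !RintegralZl.
Qed.

Lemma integrable_lin3 f1 f2 f3 (c1 c2 c3 : R) : L.-integrable D (EFin \o f1) ->
  L.-integrable D (EFin \o f2) -> L.-integrable D (EFin \o f3) ->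
  L.-integrable D (EFin \o (fun x => c1 * f1 x + c2 * f2 x + c3 * f3 x)).
Proof.
by move=> i1 i2 i3; apply: integrableDR; [apply: integrableDR|]; exact: integrableZR.
Qed.

Lemma le_Rintegral_lin3 f f1 f2 f3 (c1 c2 c3 : R) :
  L.-integrable D (EFin \o f) -> L.-integrable D (EFin \o f1) ->
  L.-integrable D (EFin \o f2) -> L.-integrable D (EFin \o f3) ->
  (forall x, D x -> f x <= c1 * f1 x + c2 * f2 x + c3 * f3 x) ->
  \int[L]_(x in D) f x <= c1 * \int[L]_(x in D) f1 x
    + c2 * \int[L]_(x in D) f2 x + c3 * \int[L]_(x in D) f3 x.
Proof.
move=> if_ i1 i2 i3 h; rewrite -Rintegral_lin3//; apply: le_Rintegral => //.
exact: integrable_lin3.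
Qed.

(** The negative part of [g] is dominated by that of [f], so the integral of [g] can only diverge to
    [+oo]. This excludes any ambiguous value of the relative entropy. *)
Lemma integrable_or_pinfty f g : L.-integrable D (EFin \o f) ->
  measurable_fun D g -> (forall x, D x -> f x <= g x) ->
  L.-integrable D (EFin \o g) \/ (\int[L]_(x in D) (g x)%:E = +oo)%E.
Proof.
move=> if_ mg fg.
have mgE : measurable_fun D (EFin \o g) by exact/measurable_EFinP.
have ineg : (\int[L]_(x in D) ((EFin \o g)^\- x) < +oo)%E.
  apply: (le_lt_trans _ (integral_funeneg_lt_pinfty mD if_)).
  apply: ge0_le_integral => //; first exact: measurable_funeneg.
    by apply: measurable_funeneg; exact: (measurable_int L if_).
  move=> x Dx; rewrite !funenegE/= -!EFin_max lee_fin.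
  by rewrite ge_max !le_max lerN2 fg// lexx orbT.
have [ipos|] := ltP (\int[L]_(x in D) ((EFin \o g)^\+ x))%E +oo%E.
  left; apply/integrableP; split => //.
  under eq_integral do rewrite -/((abse \o (EFin \o g)) _) fune_abse.
  rewrite ge0_integralD//; first exact: lte_add_pinfty.
    exact: measurable_funepos.
  exact: measurable_funeneg.
rewrite leye_eq => /eqP ipos; right.
rewrite integralE [X in (X - _)%E]ipos addye// eqe_oppLR/=.
by rewrite lt_eqF.
Qed.

End Rintegral_bounds.

Lemma weight_ratio (R : realType) (a b q Z W : R) : 0 < Z -> 0 < W ->
  expR a * q / Z = expR b * q / W * expR ((a - b) - (ln Z - ln W)).
Proof.
move=> Z0 W0; rewrite opprB addrC !expRD !expRN !lnK ?posrE//.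
by field; rewrite !gt_eqF ?expR_gt0.
Qed.

Section gibbs.
Context d (T : measurableType d) (R : realType).
Variables (L : {measure set T -> \bar R}) (X : set T).
Hypothesis mX : measurable X.
Variable q : T -> R.
Hypothesis mq : measurable_fun X q.
Hypothesis q_gt0 : forall x, X x -> 0 < q x.
Hypothesis q_int1 : (\int[L]_(x in X) (q x)%:E = 1)%E.
Implicit Types (G H p : T -> R) (k e c : R).

Definition partition_function G := \int[L]_(x in X) (expR (G x) * q x).

Definition gibbs G x := expR (G x) * q x / partition_function G.

(** The integrand of [KL], for an arbitrary pointwise representative of the density; it vanishes
    where [p] does. *)
Definition entropy_integrand p x := ln (p x / q x) * p x.

Let iq : L.-integrable X (EFin \o q).
Proof. by apply: integrable_unit_mass => // x Xx; exact: ltW (q_gt0 Xx). Qed.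

Let q1 : \int[L]_(x in X) q x = 1. Proof. by rewrite /Rintegral q_int1. Qed.

Lemma measurable_entropy_integrand p : measurable_fun X p ->
  measurable_fun X (entropy_integrand p).
Proof.
move=> mp; apply: measurable_funM => //; apply: measurableT_comp => //.
apply: measurable_funM => //.
(* Positivity of [q] on [X] lets its inverse be written with [expR] and [ln], both measurable. *)
apply: (eq_measurable_fun (fun x => expR (- ln (q x)))).
  by move=> x /[!inE] Xx; rewrite expRN lnK// posrE q_gt0.
by do 2 apply: measurableT_comp => //; exact: measurableT_comp.
Qed.

Section bounded_field.
Variables (G : T -> R) (k : R).
Hypotheses (mG : measurable_fun X G) (Gk : forall x, X x -> `|G x| <= k).

Let mweight : measurable_fun X (fun x => expR (G x) * q x).
Proof. by apply: measurable_funM => //; exact: measurableT_comp. Qed.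

Let weight_bound x : X x ->
  expR (- k) * q x <= expR (G x) * q x <= expR k * q x.
Proof.
by move=> Xx; rewrite !ler_pM2r ?q_gt0// !ler_expR -ler_norml Gk.
Qed.

Lemma integrable_weight :
  L.-integrable X (EFin \o (fun x => expR (G x) * q x)).
Proof.
apply: (le_integrableR mX _ (integrableZR mX (expR k) iq)) => // x Xx.
by rewrite ger0_norm ?mulr_ge0 ?expR_ge0// ?(ltW (q_gt0 _))//; case/andP: (weight_bound Xx).
Qed.

Lemma partition_function_bound : expR (- k) <= partition_function G <= expR k.
Proof.
have iw := integrable_weight.
apply/andP; split.
  rewrite -[leLHS]mulr1 -q1 -RintegralZl//; apply: le_Rintegral => //.
    exact: integrableZR.
  by move=> x /weight_bound/andP[].
rewrite -[leRHS]mulr1 -q1 -RintegralZl//; apply: le_Rintegral => //.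
  exact: integrableZR.
by move=> x /weight_bound/andP[].
Qed.

Lemma partition_function_gt0 : 0 < partition_function G.
Proof.
by case/andP: partition_function_bound => + _; apply: lt_le_trans; exact: expR_gt0.
Qed.

(** One [k] in the exponent comes from the weight and one from the partition function. *)
Lemma gibbs_bound x : X x ->
  expR (- (k *+ 2)) * q x <= gibbs G x <= expR (k *+ 2) * q x.
Proof.
move=> Xx; have /andP[w1 w2] := weight_bound Xx.
have Z0 := partition_function_gt0; have /andP[Z1 Z2] := partition_function_bound.
rewrite ler_pdivlMr// ler_pdivrMr//; apply/andP; split.
  apply: le_trans w1; rewrite mulr2n opprD expRD mulrAC ler_pM2r ?q_gt0//.
  by rewrite -mulrA ger_pMr ?expR_gt0// expRN mulrC ler_pdivrMr ?expR_gt0// mul1r.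
apply: (le_trans w2); rewrite mulr2n expRD mulrAC ler_pM2r ?q_gt0//.
rewrite -mulrA ler_pMr ?expR_gt0//.
by rewrite mulrC -ler_pdivrMr ?expR_gt0// mul1r -expRN.
Qed.

Lemma gibbs_gt0 x : X x -> 0 < gibbs G x.
Proof.
by move=> Xx; rewrite divr_gt0 ?partition_function_gt0// mulr_gt0 ?expR_gt0 ?q_gt0.
Qed.

Lemma measurable_gibbs : measurable_fun X (gibbs G).
Proof. by apply: measurable_funM. Qed.

Lemma integrable_gibbs : L.-integrable X (EFin \o gibbs G).
Proof.
apply: (le_integrableR mX measurable_gibbs (integrableZR mX (expR (k *+ 2)) iq)).
by move=> x Xx; rewrite gtr0_norm ?gibbs_gt0//; case/andP: (gibbs_bound Xx).
Qed.

Lemma Rintegral_gibbs : \int[L]_(x in X) gibbs G x = 1.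
Proof.
by rewrite RintegralZr ?integrable_weight// divff// gt_eqF// partition_function_gt0.
Qed.

Lemma ln_gibbs x : X x -> ln (gibbs G x / q x) = G x - ln (partition_function G).
Proof.
move=> Xx; have q0 := q_gt0 Xx; have Z0 := partition_function_gt0.
rewrite /gibbs mulrAC mulfK ?gt_eqF// ln_div ?posrE ?expR_gt0//.
by rewrite expRK.
Qed.

Lemma integrable_gibbsM H e : measurable_fun X H ->
  (forall x, X x -> `|H x| <= e) ->
  L.-integrable X (EFin \o (fun x => gibbs G x * H x)).
Proof.
move=> mH He.
apply: (le_integrableR mX _ (integrableZR mX e integrable_gibbs)).
  by apply: measurable_funM => //; exact: measurable_gibbs.
move=> x Xx; rewrite normrM gtr0_norm ?gibbs_gt0// mulrC ler_pM2r ?gibbs_gt0//.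
exact: He.
Qed.

(** The factor 1 and the null term in [q] only give the expression the shape of [Rintegral_lin3]. *)
Lemma entropy_gibbsE x : X x -> entropy_integrand (gibbs G) x =
  1 * (gibbs G x * G x) + (- ln (partition_function G)) * gibbs G x + 0 * q x.
Proof. by move=> Xx; rewrite /entropy_integrand ln_gibbs//; ring. Qed.

Lemma integrable_entropy_gibbs :
  L.-integrable X (EFin \o entropy_integrand (gibbs G)).
Proof.
apply: (@eq_integrable _ _ _ L X mX (EFin \o (fun x => 1 * (gibbs G x * G x) +
    (- ln (partition_function G)) * gibbs G x + 0 * q x))).
  by move=> x /[!inE] Xx; rewrite /= -entropy_gibbsE.
apply: integrable_lin3 => //; last exact: integrable_gibbs.
exact: (integrable_gibbsM mG Gk).
Qed.

Lemma Rintegral_entropy_gibbs :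
  \int[L]_(x in X) entropy_integrand (gibbs G) x =
  \int[L]_(x in X) (gibbs G x * G x) - ln (partition_function G).
Proof.
under eq_Rintegral => x /[!inE] Xx do rewrite entropy_gibbsE//.
rewrite Rintegral_lin3//; first last.
- exact: integrable_gibbs.
- exact: (integrable_gibbsM mG Gk).
by rewrite Rintegral_gibbs mul1r mulr1 mul0r addr0.
Qed.

End bounded_field.

(** The two densities differ by a factor [exp r], where [r] is the difference of the fields minus
    that of the logarithms of the partition functions. The argument yields [2 exp (6 k)], rounded up
    in the statement. *)
Lemma gibbs_lipschitz G G' k e : measurable_fun X G -> measurable_fun X G' ->
  (forall x, X x -> `|G x| <= k) -> (forall x, X x -> `|G' x| <= k) ->
  (forall x, X x -> `|G' x - G x| <= e) ->
  forall x, X x -> `|gibbs G' x - gibbs G x| <= 4 * expR (k *+ 8) * e * q x.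
Proof.
move=> mG mG' Gk Gk' GG' x Xx.
have q0 := q_gt0 Xx.
have Z0 := partition_function_gt0 mG Gk; have Z0' := partition_function_gt0 mG' Gk'.
have e0 : 0 <= e := le_trans (normr_ge0 _) (GG' _ Xx).
have k0 : 0 <= k := le_trans (normr_ge0 _) (Gk _ Xx).
(* Both bounds in the minimum are used: [e] makes the estimate small, while [k *+ 2] keeps the
   exponential constant independent of [e], which is not assumed to be bounded. They follow from the
   monotonicity of the partition function, since adding a constant [m] to a field multiplies it by
   [exp m]. *)
have ZZ : `|ln (partition_function G') - ln (partition_function G)| <= Num.min e (k *+ 2).
  set m := Num.min _ _.
  have Gm y : X y -> `|G' y - G y| <= m.
    move=> Xy; rewrite le_min GG'//= (le_trans (ler_normB _ _))//.
    by rewrite mulr2n lerD ?Gk ?Gk'.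
  have H (A B : T -> R) : measurable_fun X A -> measurable_fun X B ->
      (forall x, X x -> `|A x| <= k) -> (forall x, X x -> `|B x| <= k) ->
      (forall y, X y -> `|A y - B y| <= m) ->
      ln (partition_function A) - ln (partition_function B) <= m.
    move=> mA mB Ak Bk AB.
    have ZA := partition_function_gt0 mA Ak; have ZB := partition_function_gt0 mB Bk.
    rewrite lerBlDr -[m]expRK -lnM ?posrE ?expR_gt0// ler_ln ?posrE ?mulr_gt0 ?expR_gt0//.
    rewrite -RintegralZl//; last exact: integrable_weight Bk.
    apply: le_Rintegral => //; first exact: integrable_weight Ak.
      by apply: integrableZR => //; exact: integrable_weight Bk.
    move=> y Xy; rewrite mulrA -expRD ler_pM2r ?q_gt0// ler_expR -lerBlDr.
    by rewrite (le_trans (ler_norm _))// AB.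
  rewrite ler_norml lerNl opprB; apply/andP; split.
    by apply: H; [exact: mG|exact: mG'|exact: Gk|exact: Gk'|move=> y Xy; rewrite distrC Gm].
  by apply: H; [exact: mG'|exact: mG|exact: Gk'|exact: Gk|exact: Gm].
have gE : gibbs G' x = gibbs G x * expR ((G' x - G x) -
    (ln (partition_function G') - ln (partition_function G))) by exact: weight_ratio.
set r := _ - _ in gE.
have rk : `|r| <= Num.min (e *+ 2) (k *+ 4).
  rewrite (le_trans (ler_normB _ _))// le_min; apply/andP; split.
    by rewrite mulr2n lerD ?GG'// (le_trans ZZ)// ge_min lexx.
  rewrite (_ : k *+ 4 = k *+ 2 + k *+ 2); last by rewrite -mulrnDr.
  rewrite lerD//; last by rewrite (le_trans ZZ)// ge_min lexx orbT.
  by rewrite (le_trans (ler_normB _ _))// mulr2n lerD ?Gk ?Gk'.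
move: rk; rewrite le_min => /andP[re rk].
rewrite gE -[X in _ - X]mulr1 -mulrBr normrM gtr0_norm ?(gibbs_gt0 mG Gk)//.
have /andP[_ gb] := gibbs_bound mG Gk Xx.
have h := expR_lipschitz rk.
apply: (@le_trans _ _ ((expR (k *+ 2) * q x) * (expR (k *+ 4) * (e *+ 2)))).
  rewrite ler_pM// ?(ltW (gibbs_gt0 mG Gk _))//.
  by rewrite (le_trans h)// ler_pM2l// expR_gt0.
have E6 : expR (k *+ 2) * expR (k *+ 4) = expR (k *+ 6) by rewrite -expRD -mulrnDr.
have le68 : expR (k *+ 6) <= expR (k *+ 8) by rewrite ler_expR ler_wpMn2l.
have eq0 : 0 <= e * q x by rewrite mulr_ge0// ltW.
have {}le68 := ler_wpM2r eq0 le68.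
rewrite (_ : _ * _ = 2 * (expR (k *+ 2) * expR (k *+ 4) * (e * q x))); last by ring.
have : 0 <= expR (k *+ 8) * (e * q x) by rewrite mulr_ge0 ?expR_ge0.
by rewrite E6 -[4 * _ * _ * _]mulrA -[4 * _ * _]mulrA; lra.
Qed.

(* Gibbs' variational principle, tested against the Gibbs density of [G1]. *)
Lemma partition_function_jensen G0 G1 k : measurable_fun X G0 -> measurable_fun X G1 ->
  (forall x, X x -> `|G0 x| <= k) -> (forall x, X x -> `|G1 x| <= k) ->
  \int[L]_(x in X) (gibbs G1 x * G0 x) - \int[L]_(x in X) (gibbs G1 x * G1 x)
    + ln (partition_function G1) <= ln (partition_function G0).
Proof.
move=> mG0 mG1 G0k G1k.
have Z0 := partition_function_gt0 mG0 G0k; have Z1 := partition_function_gt0 mG1 G1k.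
have i0 := integrable_gibbsM mG1 G1k mG0 G0k.
have i1 := integrable_gibbsM mG1 G1k mG1 G1k.
have ig0 := integrable_gibbs mG0 G0k; have ig1 := integrable_gibbs mG1 G1k.
(* Nonnegativity of the entropy of [gibbs G1] relative to [gibbs G0]: the inequality
   [1 + r <= exp r], with [r] the logarithm of the ratio of the densities, is integrated against
   [gibbs G1]. *)
have : \int[L]_(x in X) (gibbs G1 x * G0 x) <=
    1 * \int[L]_(x in X) (gibbs G1 x * G1 x)
    + (ln (partition_function G0) - ln (partition_function G1) - 1) *
      \int[L]_(x in X) gibbs G1 x + 1 * \int[L]_(x in X) gibbs G0 x.
  apply: le_Rintegral_lin3; [exact: mX|exact: i0|exact: i1|exact: ig1|exact: ig0|].
  move=> x Xx; have g1 := gibbs_gt0 mG1 G1k Xx; have q0 := q_gt0 Xx.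
  have -> : gibbs G0 x = gibbs G1 x * expR ((G0 x - G1 x) -
    (ln (partition_function G0) - ln (partition_function G1))) by exact: weight_ratio.
  have := expR_ge1Dx ((G0 x - G1 x) -
    (ln (partition_function G0) - ln (partition_function G1))).
  rewrite -(ler_pM2l g1); move: (ln _) (ln _) (expR _) (gibbs _ _) => *; lra.
rewrite (Rintegral_gibbs mG0 G0k) (Rintegral_gibbs mG1 G1k).
move: (ln _) (ln _) (Rintegral _ _ _) (Rintegral _ _ _) => *; lra.
Qed.

(** Let [D] be the entropy of [gibbs G1], and let integrals of fields be taken against [gibbs G1].
    Convexity contributes [c D]. Since [ln Z(G1) = \int G1 - D], adding it leaves
    [\int G1 - (1 - c) D]. Replacing [G1] by [(1 - c) G0 + c H] turns this into
    [c \int H + (1 - c) (\int G0 - D)], and the last bracket is at most [ln Z(G0)] by the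
    variational principle. This is why the target is the best response to the field at the end of
    the step. In the constant, [1 + k *+ 2] comes from the entropy error and 1 from the field
    error. *)
Lemma player_step p0 p1 G0 G1 H k e c : 0 <= k -> 0 < c <= 1 ->
  measurable_fun X p0 -> measurable_fun X p1 -> measurable_fun X H ->
  measurable_fun X G0 -> measurable_fun X G1 ->
  (forall x, X x -> 0 <= p0 x) ->
  (forall x, X x -> `|G0 x| <= k) -> (forall x, X x -> `|G1 x| <= k) ->
  (forall x, X x -> `|H x| <= k) ->
  L.-integrable X (EFin \o entropy_integrand p0) ->
  (forall x, X x -> (1 - c) * p0 x + c * (expR (- (k *+ 2)) * q x) <= p1 x
                 <= (1 - c) * p0 x + c * (expR (k *+ 2) * q x)) ->
  (forall x, X x -> `|p1 x - (1 - c) * p0 x - c * gibbs G1 x| <= c * (e * q x)) ->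
  (forall x, X x -> `|G1 x - (1 - c) * G0 x - c * H x| <= c * e) ->
  L.-integrable X (EFin \o entropy_integrand p1) /\
  \int[L]_(x in X) entropy_integrand p1 x + ln (partition_function G1) <=
  (1 - c) * (\int[L]_(x in X) entropy_integrand p0 x + ln (partition_function G0))
  + c * \int[L]_(x in X) (gibbs G1 x * H x) + c * ((2 + k *+ 2) * e).
Proof.
move=> k0 /andP[c0 c1] mp0 mp1 mH mG0 mG1 p0_ge0 G0k G1k Hk ip0 p01 p1e G1e.
have ieg := integrable_entropy_gibbs mG1 G1k.
have c01 : 0 < c <= 1 by rewrite c0.
have step x : X x -> entropy_integrand p1 x <= (1 - c) * entropy_integrand p0 x
    + c * entropy_integrand (gibbs G1) x + c * ((1 + k *+ 2) * e) * q x.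
  move=> Xx; apply: entropy_step => //.
  - exact: q_gt0.
  - exact: p0_ge0.
  - exact: ltW (gibbs_gt0 mG1 G1k Xx).
  - by rewrite mulrn_wge0.
  - exact: p01.
  - exact: p1e.
have mr := measurable_entropy_integrand.
(* The integrand is bounded above by [step] and below by [- q], through the tangent at [q]. *)
have ip1 : L.-integrable X (EFin \o entropy_integrand p1).
  have iu := integrable_lin3 mX (1 - c) c (c * ((1 + k *+ 2) * e)) ip0 ieg iq.
  apply: (le_integrableR mX (mr _ mp1) (integrableDR mX (integrable_norm iu) iq)).
  move=> x Xx; have := step x Xx.
  have q0 := q_gt0 Xx.
  have p1_ge0 : 0 <= p1 x.
    case/andP: (p01 x Xx) => + _; apply: le_trans.
    rewrite addr_ge0// mulr_ge0 ?subr_ge0 ?p0_ge0//; first exact: ltW.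
    by rewrite mulr_ge0 ?expR_ge0// ltW.
  have := entropy_tangent p1_ge0 q0 q0; rewrite divff ?gt_eqF// ln1 mul0r add0r.
  rewrite -/(entropy_integrand p1 x) => h1 h2.
  rewrite /=; move: h2; set B := (X in _ <= X) => h2.
  have := normr_ge0 B; have := ler_norm B; rewrite ler_norml.
  by move=> *; apply/andP; split; lra.
split => //.
have h1 : \int[L]_(x in X) entropy_integrand p1 x <=
    (1 - c) * \int[L]_(x in X) entropy_integrand p0 x
    + c * \int[L]_(x in X) entropy_integrand (gibbs G1) x
    + c * ((1 + k *+ 2) * e) * \int[L]_(x in X) q x.
  exact: le_Rintegral_lin3.
rewrite q1 mulr1 (Rintegral_entropy_gibbs mG1 G1k) in h1.
have h2 := partition_function_jensen mG0 mG1 G0k G1k.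
have i0 := integrable_gibbsM mG1 G1k mG0 G0k.
have i1 := integrable_gibbsM mG1 G1k mG1 G1k.
have iH := integrable_gibbsM mG1 G1k mH Hk.
have ig1 := integrable_gibbs mG1 G1k.
have h3 : \int[L]_(x in X) (gibbs G1 x * G1 x) - c * \int[L]_(x in X) (gibbs G1 x * H x)
    - c * e <= (1 - c) * \int[L]_(x in X) (gibbs G1 x * G0 x).
  have : \int[L]_(x in X) (gibbs G1 x * G1 x) <=
      (1 - c) * \int[L]_(x in X) (gibbs G1 x * G0 x)
      + c * \int[L]_(x in X) (gibbs G1 x * H x) + c * e * \int[L]_(x in X) gibbs G1 x.
    apply: le_Rintegral_lin3; [exact: mX|exact: i1|exact: i0|exact: iH|exact: ig1|].
    move=> x Xx; have := le_trans (ler_norm _) (G1e x Xx).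
    rewrite -(ler_pM2l (gibbs_gt0 mG1 G1k Xx)).
    by move: (gibbs _ _) => *; lra.
  rewrite (Rintegral_gibbs mG1 G1k).
  by move: (Rintegral _ _ _) (Rintegral _ _ _) (Rintegral _ _ _) => *; lra.
have h4 : (1 - c) * (\int[L]_(x in X) (gibbs G1 x * G0 x)
    - \int[L]_(x in X) (gibbs G1 x * G1 x) + ln (partition_function G1))
    <= (1 - c) * ln (partition_function G0) by rewrite ler_wpM2l// subr_ge0.
move: h1 h3 h4.
move: (ln _) (ln _) (Rintegral _ _ _) (Rintegral _ _ _) (Rintegral _ _ _)
  (Rintegral _ _ _) (Rintegral _ _ _).
move=> *; lra.
Qed.

End gibbs.

(** * Densities and relative entropy *)

Section density_probability.
Context d (T : measurableType d) (R : realType).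
Variables (L : {measure set T -> \bar R}) (X : set T) (p : T -> R).
Hypotheses (mX : measurable X) (mp : measurable_fun X p).
Hypotheses (p_ge0 : forall x, X x -> 0 <= p x).
Hypothesis p_int1 : (\int[L]_(x in X) (p x)%:E = 1)%E.

(** Turns a normalized density into a bundled probability, so that the best responses can serve as
    competitors in [NI]. *)
Definition density_measure (A : set T) : \bar R :=
  (\int[L]_(x in A `&` X) (p x)%:E)%E.

Let density_measure0 : density_measure set0 = 0%E.
Proof. by rewrite /density_measure set0I integral_set0. Qed.

Let density_measure_ge0 A : (0 <= density_measure A)%E.
Proof. by apply: integral_ge0 => x [_ Xx]; rewrite lee_fin p_ge0. Qed.

Let density_measure_sigma_additive : semi_sigma_additive density_measure.
Proof.
move=> F mF tF mUF; rewrite /density_measure setI_bigcupl ge0_integral_bigcup//=.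
- apply: is_cvg_nneseries => n _ _; apply: integral_ge0 => x [_ Xx].
  by rewrite lee_fin p_ge0.
- by move=> k; exact: measurableI.
- apply/measurable_EFinP; apply: measurable_funS mp => //.
  by apply: bigcup_sub => k _; exact: subIsetr.
- by move=> x [k _ [_ Xx]]; rewrite lee_fin p_ge0.
- by apply: trivIset_setIr.
Qed.

HB.instance Definition _ := isMeasure.Build _ _ _ density_measure
  density_measure0 density_measure_ge0 density_measure_sigma_additive.

Let density_measure_setT : density_measure setT = 1%E.
Proof. by rewrite /density_measure setTI. Qed.

HB.instance Definition _ :=
  Measure_isProbability.Build _ _ _ density_measure density_measure_setT.

Definition density_probability : probability T R := density_measure.

End density_probability.

Section densities.
Context {R : realType} {n : nat}.
Local Notation E := 'rV[R]_n.
Local Notation L := (lebesgue_rV R n).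
Variable X : set E.
Hypothesis mX : measurable X.
Implicit Types (m : probability E R) (p q g G : E -> R).

Lemma is_density_integral1 m p : probs X m -> is_density X m p ->
  (\int[L]_(x in X) (p x)%:E = 1)%E.
Proof. by move=> mX1 [_ _ mE]; rewrite -mX1 mE// setIid. Qed.

Lemma is_density_integrable m p : probs X m -> is_density X m p ->
  L.-integrable X (EFin \o p).
Proof.
move=> Xm mp; have [mep p0 _] := mp; apply: integrable_unit_mass => //.
exact: is_density_integral1 Xm mp.
Qed.

Lemma is_density_dominates m p : is_density X m p -> m `<< L.
Proof.
move=> [mp p0 mE]; apply/null_content_dominatesP => A mA A0; rewrite mE//.
apply: null_set_integral; first exact: measurableI.
  by apply/measurable_EFinP; apply: measurable_funS mp => //; exact: subIsetr.
by apply: subset_measure0 A0 => //; do ?[exact: measurableI]; exact: subIsetl.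
Qed.

(** Bridge between the two densities in use: [KL] refers to the Radon-Nikodym derivative, whereas
    the flow fixes a pointwise representative. They have the same integral over every measurable
    subset of [X]. *)
Lemma ae_eq_Radon_Nikodym_density m p : is_density X m p ->
  ae_eq L X (Radon_Nikodym (charge_of_finite_measure m) L) (EFin \o p).
Proof.
move=> mp; have mL := is_density_dominates mp; case: mp => mp p0 mE.
apply: integral_ae_eq => //.
- by apply: (integrableS measurableT) => //; exact: Radon_Nikodym_integrable.
- exact/measurable_EFinP.
- move=> A AX mA; rewrite -Radon_Nikodym_integral//= /charge_of_finite_measure.
  by rewrite mE// setIidl.
Qed.

Lemma Rintegral_is_density m p g k : is_density X m p ->
  measurable_fun X g -> (forall x, X x -> `|g x| <= k) ->
  \int[m]_(x in X) g x = \int[L]_(x in X) (p x * g x).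
Proof.
move=> mp mg gk; have mL := is_density_dominates mp.
have ae := ae_eq_Radon_Nikodym_density mp.
rewrite /Rintegral -(Radon_Nikodym_change_of_variables mL mX); last first.
  apply: (le_integrableR mX mg (g := cst k)) => //.
  exact: finite_measure_integrable_cst.
congr fine; apply: ae_eq_integral => //.
- apply: emeasurable_funM; first exact/measurable_EFinP.
  by apply: measurable_funTS; apply: measurable_int; exact: Radon_Nikodym_integrable.
- by apply/measurable_EFinP; apply: measurable_funM => //; case: mp.
- apply: filterS ae => x /= + Xx => ->//.
  by rewrite muleC.
Qed.

(** The derivative chosen here is finite and nonnegative everywhere, as the pointwise conditions in
    [is_density] demand. *)
Lemma dominates_is_density m : probs X m -> m `<< L -> exists p, is_density X m p.
Proof.
move=> Xm mL; pose f := Radon_Nikodym_SigmaFinite.f m L.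
have fE x : (fine (f x))%:E = f x.
  by rewrite fineK//; exact: Radon_Nikodym_SigmaFinite.f_fin_num.
have mf : measurable_fun setT f.
  by apply: measurable_int; exact: Radon_Nikodym_SigmaFinite.f_integrable.
exists (fine \o f); split.
- by apply: measurable_funTS; apply: measurableT_comp.
- by move=> x _; rewrite fine_ge0//; exact: Radon_Nikodym_SigmaFinite.f_ge0.
- move=> A mA; have -> : m A = m (A `&` X).
    have mXC : m (~` X) = 0%E by rewrite probability_setC// Xm subee.
    have {1}-> : A = (A `&` X) `|` (A `&` ~` X) by rewrite -setIUr setUv setIT.
    rewrite measureU//.
    + rewrite [X in (_ + X)%E](_ : _ = 0%E) ?adde0//.
      by apply: subset_measure0 mXC; do ?[exact: measurableC]; try exact: subIsetr;
        apply: measurableI => //; exact: measurableC.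
    + exact: measurableI.
    + by apply: measurableI => //; exact: measurableC.
    + by rewrite setIACA setICr setI0.
  rewrite (Radon_Nikodym_SigmaFinite.f_integral mL); last exact: measurableI.
  by apply: eq_integral => x _; rewrite fE.
Qed.

Section relative_entropy.
Variable q : E -> R.
Hypothesis mq : measurable_fun X q.
Hypothesis q_gt0 : forall x, X x -> 0 < q x.
Hypothesis q_int1 : (\int[L]_(x in X) (q x)%:E = 1)%E.

(** Rests on the positivity of [q]. Thanks to it, every measure with a density passes the absolute
    continuity test in [KL]. *)
Lemma reference_null_set (A : set E) : measurable A ->
  (\int[L]_(x in A `&` X) (q x)%:E = 0)%E -> L (A `&` X) = 0%E.
Proof.
move=> mA qA0; have mAX := measurableI _ _ mA mX.
have : ae_eq L (A `&` X) (EFin \o q) (cst 0%E).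
  apply/ae_eq_integral_abs => //.
    by apply/measurable_EFinP; apply: measurable_funS mq => //; exact: subIsetr.
  rewrite -qA0; apply: eq_integral => x /[!inE] -[_ Xx] /=.
  by rewrite gtr0_norm// q_gt0.
move=> [N [mN N0 NA]]; apply: subset_measure0 N0 => // x [Ax Xx].
by apply: NA => /= /(_ (conj Ax Xx)) [] /eqP; rewrite gt_eqF// q_gt0.
Qed.

Lemma KL_is_density m p : is_density X m p ->
  KL X m q = (\int[L]_(x in X) (entropy_integrand q p x)%:E)%E.
Proof.
move=> mp; have mL := is_density_dominates mp.
have ae := ae_eq_Radon_Nikodym_density mp.
have [mep _ mE] := mp.
rewrite /KL asboolT.
  apply: ae_eq_integral => //.
  - apply/measurable_EFinP.
    apply: (measurable_entropy_integrand mq q_gt0).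
    by apply: measurable_funTS; apply: (measurableT_comp (f := fine)).
  - by apply/measurable_EFinP; exact: measurable_entropy_integrand.
  - apply: filterS ae => x /= + Xx => /(_ Xx).
    by rewrite /density /entropy_integrand => ->.
move=> N qN A mA AN; rewrite mE//.
apply: null_set_integral; first exact: measurableI.
  by apply/measurable_EFinP; apply: measurable_funS mep => //; exact: subIsetr.
by apply: reference_null_set => //; exact: qN.
Qed.

Lemma KL_infinite_or_density m : probs X m ->
  KL X m q = +oo%E \/ exists p, is_density X m p.
Proof.
move=> Xm; rewrite /KL; case: asboolP => [mq'|]; last by left.
right; apply: dominates_is_density => //.
apply/null_content_dominatesP => A mA A0; apply: (mq' A) => // B mB BA.
apply: null_set_integral; first exact: measurableI.
  by apply/measurable_EFinP; apply: measurable_funS mq => //; exact: subIsetr.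
apply: subset_measure0 A0 => //; do ?[exact: measurableI].
by apply: subset_trans BA; exact: subIsetl.
Qed.

(** The tangent at [q] bounds the entropy integrand from below by [p - q], which is integrable. *)
Lemma KL_pinfty_or_integrable m p : probs X m -> is_density X m p ->
  KL X m q = +oo%E \/
  L.-integrable X (EFin \o entropy_integrand q p) /\
  KL X m q = (\int[L]_(x in X) entropy_integrand q p x)%:E.
Proof.
move=> Xm mp; rewrite (KL_is_density mp); have [mep p0 _] := mp.
have ip := is_density_integrable Xm mp.
have iq : L.-integrable X (EFin \o q).
  by apply: integrable_unit_mass => // x Xx; exact: ltW (q_gt0 Xx).
have ipq := integrableDR mX ip (integrableZR mX (-1) iq).
have le_e x : X x -> p x + (-1) * q x <= entropy_integrand q p x.
  move=> Xx; have q0 := q_gt0 Xx; have := entropy_tangent (p0 x Xx) q0 q0.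
  by rewrite divff ?gt_eqF// ln1 mul0r add0r mulN1r.
have me := measurable_entropy_integrand mq q_gt0 mep.
have [ie|->] := integrable_or_pinfty mX ipq me le_e; last by left.
by right; split => //; rewrite /Rintegral fineK//; exact: integrable_fin_num ie.
Qed.

Local Notation Z := (partition_function L X q).
Local Notation gibbs := (gibbs L X q).

Section bounded_field.
Variables (G : E -> R) (k : R).
Hypotheses (mG : measurable_fun X G) (Gk : forall x, X x -> `|G x| <= k).

(** If the entropy is finite, integrate the tangent inequality taken at the Gibbs density: its
    logarithm relative to [q] is [G - ln Z], and the two unit masses cancel. *)
Lemma gibbs_variational m : probs X m ->
  ((\int[m]_(x in X) G x)%:E - KL X m q <= (ln (Z G))%:E)%E.
Proof.
move=> Xm; have [->|[p mp]] := KL_infinite_or_density Xm; first by rewrite leNye.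
have [->|[ie ->]] := KL_pinfty_or_integrable Xm mp; first by rewrite leNye.
have [mep p0 _] := mp; have ip := is_density_integrable Xm mp.
have ig := integrable_gibbs mX mq q_gt0 q_int1 mG Gk.
rewrite -EFinB lee_fin (Rintegral_is_density mp mG Gk).
have ipG : L.-integrable X (EFin \o (fun x => p x * G x)).
  apply: (le_integrableR mX _ (integrableZR mX k ip)); first exact: measurable_funM.
  by move=> x Xx; rewrite normrM (ger0_norm (p0 x Xx)) mulrC ler_wpM2r ?p0 ?Gk.
have : \int[L]_(x in X) (p x * G x) <= 1 * \int[L]_(x in X) entropy_integrand q p x
    + (ln (Z G) - 1) * \int[L]_(x in X) p x + 1 * \int[L]_(x in X) gibbs G x.
  apply: le_Rintegral_lin3; [exact: mX|exact: ipG|exact: ie|exact: ip|exact: ig|].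
  move=> x Xx; have g0 := gibbs_gt0 mX mq q_gt0 q_int1 mG Gk Xx.
  have := entropy_tangent (p0 x Xx) g0 (q_gt0 Xx).
  rewrite (ln_gibbs mX mq q_gt0 q_int1 mG Gk Xx) -/(entropy_integrand q p x).
  by move: (entropy_integrand _ _ _) (gibbs _ _) (ln _) => *; lra.
rewrite (Rintegral_gibbs mX mq q_gt0 q_int1 mG Gk).
have -> : \int[L]_(x in X) p x = 1 by rewrite /Rintegral (is_density_integral1 Xm mp).
by move: (Rintegral _ _ _) (Rintegral _ _ _) (ln _) => *; lra.
Qed.

Lemma gibbs_measure : exists2 m, probs X m & is_density X m (gibbs G).
Proof.
have mg := measurable_gibbs L mq mG.
have g0 x : X x -> 0 <= gibbs G x.
  by move=> Xx; exact: ltW (gibbs_gt0 mX mq q_gt0 q_int1 mG Gk Xx).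
have g1 : (\int[L]_(x in X) (gibbs G x)%:E = 1)%E.
  have := Rintegral_gibbs mX mq q_gt0 q_int1 mG Gk; rewrite /Rintegral => h.
  rewrite -[LHS]fineK ?h//; apply: integrable_fin_num => //.
  exact: (integrable_gibbs mX mq q_gt0 q_int1 mG Gk).
exists (density_probability mX mg g0 g1); last by split.
by rewrite /probs /= /density_probability /= /density_measure setIid.
Qed.

(** The equality case of [gibbs_variational]. *)
Lemma KL_gibbs m : probs X m -> is_density X m (gibbs G) ->
  KL X m q = (\int[m]_(x in X) G x - ln (Z G))%:E.
Proof.
move=> Xm mg; rewrite (KL_is_density mg) (Rintegral_is_density mg mG Gk).
rewrite -(Rintegral_entropy_gibbs mX mq q_gt0 q_int1 mG Gk) /Rintegral fineK//.
apply: integrable_fin_num => //.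
exact: (integrable_entropy_gibbs mX mq q_gt0 q_int1 mG Gk).
Qed.

End bounded_field.
End relative_entropy.
End densities.

(** * Bounded kernels *)

Section bounded_kernel.
Context d1 d2 (T1 : measurableType d1) (T2 : measurableType d2) (R : realType).
Variables (X : set T1) (Y : set T2) (f : T1 -> T2 -> R) (K : R).
Hypotheses (mX : measurable X) (mY : measurable Y).
Hypothesis mf : measurable_fun (X `*` Y) (fun z => f z.1 z.2).
Hypothesis fK : forall x y, X x -> Y y -> `|f x y| <= K.

(** Extension by zero gives a bounded measurable function on the whole product, hence integrable for
    every product of probabilities. *)
Let g : T1 * T2 -> R := (fun z => f z.1 z.2) \_ (X `*` Y).

Let gE x y : X x -> Y y -> g (x, y) = f x y.
Proof. by move=> Xx Yy; rewrite /g patchE mem_set. Qed.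

Let g_out x y : ~ (X x /\ Y y) -> g (x, y) = 0.
Proof. by move=> XY; rewrite /g patchE memNset. Qed.

Let mg : measurable_fun setT g.
Proof. exact/(measurable_restrictT _ (measurableX mX mY)). Qed.

Let gK z : `|g z| <= `|K|.
Proof.
case: z => x y; have [[Xx Yy]|XY] := pselect (X x /\ Y y).
  by rewrite gE// (le_trans (fK Xx Yy))// ler_norm.
by rewrite g_out// normr0.
Qed.

Let integrable_g (m1 : probability T1 R) (m2 : probability T2 R) :
  (m1 \x m2)%E.-integrable setT (EFin \o g).
Proof.
apply: measurable_bounded_integrable => //.
- rewrite -setXTT; apply: (@le_lt_trans _ _ (m1 setT * m2 setT)%E).
    by rewrite -product_measure1E.
  by rewrite !probability_setT mule1 ltry.
- exists (`|K|); split; first exact: num_real.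
  by move=> M KM z _ /=; rewrite (le_trans (gK z))// ltW.
Qed.

Let Rintegral_g2 (m2 : probability T2 R) x : X x ->
  \int[m2]_(y in Y) f x y = \int[m2]_y g (x, y).
Proof.
move=> Xx; rewrite Rintegral_mkcond; apply: eq_Rintegral => y _.
rewrite patchE; case: ifPn => [/[!inE] Yy|/negP/[!inE] Yy]; first by rewrite gE.
by rewrite g_out// => -[].
Qed.

Let Rintegral_g1 (m1 : probability T1 R) y : Y y ->
  \int[m1]_(x in X) f x y = \int[m1]_x g (x, y).
Proof.
move=> Yy; rewrite Rintegral_mkcond; apply: eq_Rintegral => x _.
rewrite patchE; case: ifPn => [/[!inE] Xx|/negP/[!inE] Xx]; first by rewrite gE.
by rewrite g_out// => -[].
Qed.

Lemma measurable_kernel_section2 x : X x -> measurable_fun Y (f x).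
Proof.
move=> Xx; apply: (measurable_comp _ _ mf (g := fun y => (x, y))).
- exact: measurableX.
- by move=> _ [y Yy <-].
- exact: measurable_funTS (measurable_pair1 x).
Qed.

Lemma measurable_kernel_section1 y : Y y -> measurable_fun X (f^~ y).
Proof.
move=> Yy; apply: (measurable_comp _ _ mf (g := fun x => (x, y))).
- exact: measurableX.
- by move=> _ [x Xx <-].
- exact: measurable_funTS (measurable_pair2 y).
Qed.

Lemma measurable_kernel_swap : measurable_fun (Y `*` X) (fun z => f z.2 z.1).
Proof.
apply: (measurable_comp (F := X `*` Y) (f := fun z => f z.1 z.2) (g := fun z => (z.2, z.1))) => //.
- exact: measurableX.
- by move=> _ [[y x] [/= Yy Xx] <-].
- apply: measurable_funTS; apply: measurable_fun_pair; first exact: measurable_snd.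
  exact: measurable_fst.
Qed.

Lemma measurable_Rintegral_kernel2 (m2 : probability T2 R) :
  measurable_fun X (fun x => \int[m2]_(y in Y) f x y).
Proof.
(* A point of [X] supplies a Dirac mass as first factor of the product measure for which [g] is
   integrable. *)
have [[x0 Xx0]|X0] := pselect (X !=set0); last first.
  have -> : X = set0 by apply/seteqP; split => // x Xx; apply: X0; exists x.
  exact: measurable_fun_set0.
apply: (eq_measurable_fun (fun x => \int[m2]_y g (x, y))).
  by move=> x /[!inE] Xx; rewrite Rintegral_g2.
apply: measurable_funTS; apply: (measurableT_comp (f := fine)) => //.
exact: measurable_fubini_F (integrable_g (dirac x0) m2).
Qed.

Lemma Fubini_bounded_kernel (m1 : probability T1 R) (m2 : probability T2 R) :
  \int[m1]_(x in X) \int[m2]_(y in Y) f x y =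
  \int[m2]_(y in Y) \int[m1]_(x in X) f x y.
Proof.
have fin2 x : (\int[m2]_y (g (x, y))%:E)%E \is a fin_num.
  apply: integrable_fin_num => //.
  apply: (le_integrableR measurableT _ (finite_measure_integrable_cst m2 `|K| measurableT)).
    exact: measurableT_comp mg (measurable_pair1 x).
  by move=> y _ /=.
have fin1 y : (\int[m1]_x (g (x, y))%:E)%E \is a fin_num.
  apply: integrable_fin_num => //.
  apply: (le_integrableR measurableT _ (finite_measure_integrable_cst m1 `|K| measurableT)).
    exact: measurableT_comp mg (measurable_pair2 y).
  by move=> x _ /=.
transitivity (\int[m1]_x \int[m2]_y g (x, y)).
  rewrite Rintegral_mkcond; apply: eq_Rintegral => x _.
  rewrite patchE; case: ifPn => [/[!inE] Xx|/negP/[!inE] Xx]; first exact: Rintegral_g2.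
  by rewrite (@eq_Rintegral _ _ _ _ _ (cst 0)) ?Rintegral_cst ?mul0r// => y _;
    rewrite g_out// => -[].
transitivity (\int[m2]_y \int[m1]_x g (x, y)); last first.
  rewrite [RHS]Rintegral_mkcond; apply: eq_Rintegral => y _.
  rewrite patchE; case: ifPn => [/[!inE] Yy|/negP/[!inE] Yy].
    by rewrite Rintegral_g1.
  by rewrite (@eq_Rintegral _ _ _ _ _ (cst 0)) ?Rintegral_cst ?mul0r// => x _;
    rewrite g_out// => -[].
rewrite /Rintegral; congr fine.
under eq_integral do rewrite fineK//.
under [RHS]eq_integral do rewrite fineK//.
exact: Fubini (integrable_g m1 m2).
Qed.

End bounded_kernel.

(** * Flat derivatives of affine functions *)

Lemma initial_cvg (S : choiceType) (T : topologicalType) (f : S -> T)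
    (F : set_system S) (s : S) : Filter F ->
  f @ F --> f s -> F --> (s : initial_topology f).
Proof.
move=> FF fFs A /= [_ [[B Bop <-] Bfs sBfA]].
have : nbhs (f s) B by rewrite nbhsE; exists B.
by move=> /fFs FB; rewrite nbhs_filterE; exact: filterS sBfA FB.
Qed.

Lemma ptws_cvg (U : Type) (V : topologicalType) (F : set_system {ptws U -> V})
    (f : {ptws U -> V}) : Filter F ->
  (forall u, (fun g : {ptws U -> V} => g u) @ F --> f u) -> F --> f.
Proof.
move=> FF h; apply: (cvg_sup (fun u => Topological.class
  (initial_topology (fun g : U -> V => g u))) f FF).2 => u.
exact: (initial_cvg (f := fun g : U -> V => g u)).
Qed.

Lemma bounded_convergence d (T : measurableType d) (R : realType)
    (mu : {measure set T -> \bar R}) (D : set T) (f_ : nat -> T -> R) (f : T -> R) (C : R) :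
  measurable D -> (mu D < +oo)%E -> (forall k, measurable_fun D (f_ k)) ->
  measurable_fun D f -> (forall x, D x -> f_^~ x @ \oo --> f x) ->
  (forall k x, D x -> `|f_ k x| <= C) ->
  (fun k => \int[mu]_(x in D) f_ k x) @ \oo --> \int[mu]_(x in D) f x.
Proof.
move=> mD Dfin mf_ mf f_f f_C.
have iC : mu.-integrable D (EFin \o cst C).
  apply: measurable_bounded_integrable => //.
  exists `|C|; split; first exact: num_real.
  by move=> N CN x _ /=; rewrite ltW.
have [] := @dominated_convergence _ _ _ mu D mD (fun k => EFin \o f_ k) (EFin \o f)
  (EFin \o cst C).
- by move=> k; exact/measurable_EFinP.
- exact/measurable_EFinP.
- by apply: aeW => x Dx; apply: cvg_EFin; [exact: nearW|exact: f_f].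
- exact: iC.
- by apply: aeW => x k Dx; rewrite /= lee_fin f_C.
move=> if_ _ cvgf.
apply: fine_cvg; rewrite /Rintegral fineK//; exact: integrable_fin_num if_.
Qed.

Section flat_derivative_linear.
Context {R : realType} {n : nat}.
Local Notation E := 'rV[R]_n.
Local Notation P := (probability E R).
Variable M : set E.
Hypothesis mM : measurable M.
Implicit Types (m : P) (x : E) (phi : E -> R) (e K : R).

Lemma within_continuous_measurable_rV phi :
  {within M, continuous phi} -> measurable_fun M phi.
Proof.
move=> /continuousP cphi; apply: (measurability _ (RGenOpens.measurableE R)).
move=> _ [_ [a [b ->] <-]].
have /open_subspaceP[U oU UM] : open (phi @^-1` `]a, b[ : set (subspace M)).
  by apply: cphi; exact: interval_open.
rewrite setIC -UM; apply: measurableI => //; exact: open_measurable_rV.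
Qed.

Lemma probs_mixture e m m' : probs M m -> probs M m' -> probs M (mixture e m m').
Proof.
move=> Mm Mm'; rewrite /probs/= /mixture Mm Mm'; case: ifP => // _.
by rewrite !mule1 -EFinD subrK.
Qed.

Lemma Rintegral_mixture e m m' phi K : 0 <= e <= 1 -> probs M m -> probs M m' ->
  measurable_fun M phi -> (forall x, M x -> `|phi x| <= K) ->
  \int[mixture e m m']_(x in M) phi x =
  (1 - e) * \int[m]_(x in M) phi x + e * \int[m']_(x in M) phi x.
Proof.
move=> e01 Mm Mm' mphi phiK.
have Mmix := probs_mixture e Mm Mm'.
have iphi (m0 : P) : m0.-integrable M (EFin \o phi).
  by apply: (le_integrableR mM mphi (finite_measure_integrable_cst m0 K mM)).
(* Adding [K] makes the integrand nonnegative, so that additivity in the measure applies to extended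
   integrals. *)
have RintD (m0 : P) : probs M m0 ->
    \int[m0]_(x in M) phi x = \int[m0]_(x in M) (phi x + K) - K.
  move=> Mm0; rewrite (RintegralD mM (iphi m0) (finite_measure_integrable_cst m0 K mM)).
  by rewrite Rintegral_cst// [X in fine X](Mm0 : _ = _) mulr1 addrK.
have [e0 e1] := andP e01; have e1' : 0 <= 1 - e by rewrite subr_ge0.
have mphiK : measurable_fun M (fun x => (phi x + K)%:E).
  by apply/measurable_EFinP; exact: measurable_funD.
have phiK0 x : M x -> (0 <= (phi x + K)%:E)%E.
  by move=> Mx; rewrite lee_fin -lerBlDr sub0r; have := phiK x Mx; rewrite ler_norml => /andP[].
rewrite !RintD//.
suff -> : \int[mixture e m m']_(x in M) (phi x + K) =
    (1 - e) * \int[m]_(x in M) (phi x + K) + e * \int[m']_(x in M) (phi x + K) by ring.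
have fin (m0 : P) : (\int[m0]_(x in M) (phi x + K)%:E)%E \is a fin_num.
  apply: integrable_fin_num => //.
  exact: (integrableDR mM (iphi m0) (finite_measure_integrable_cst m0 K mM)).
rewrite /Rintegral -[RHS]/(fine (_)%:E) EFinD !EFinM !fineK ?fin//.
congr fine; pose me := measure_add (mscale (NngNum e1') m) (mscale (NngNum e0) m').
transitivity (\int[me]_(x in M) (phi x + K)%:E)%E.
  apply: eq_measure_integral => A mA _.
  transitivity ((1 - e)%:E * m A + e%:E * m' A)%E; first by rewrite /= /mixture e01.
  exact/esym/measure_addE.
by rewrite ge0_integral_measure_add// !ge0_integral_mscale.
Qed.

(** The mixtures to which this is applied converge against all bounded measurable functions, so the
    condition avoids continuity of the test functions. *)
Lemma cvg_weak_probs (m_ : nat -> P) m :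
  (forall phi K, measurable_fun M phi -> (forall x, M x -> `|phi x| <= K) ->
    (fun k => \int[m_ k]_(x in M) phi x) @ \oo --> \int[m]_(x in M) phi x) ->
  m_ @ \oo --> (m : weak_probs M).
Proof.
move=> h; apply: initial_cvg; apply: ptws_cvg => phi.
have [cphi [K [_ bphi]]] := svalP phi.
(* Boundedness only provides the constants strictly above [K]. *)
apply: (h (sval phi) (K + 1)); first exact: within_continuous_measurable_rV.
by move=> x Mx; apply: bphi => //; rewrite ltrDl.
Qed.

Lemma probs_dirac x : M x -> probs M (dirac x : P).
Proof. by move=> Mx; rewrite /probs/= diracE mem_set. Qed.

Lemma Rintegral_dirac x phi : M x -> measurable_fun M phi ->
  \int[dirac x : P]_(z in M) phi z = phi x.
Proof.
move=> Mx mphi; rewrite /Rintegral integral_dirac//; last exact/measurable_EFinP.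
by rewrite diracE mem_set// mul1e.
Qed.

Lemma Rintegral_bound m phi K : probs M m -> measurable_fun M phi ->
  (forall x, M x -> `|phi x| <= K) -> `|\int[m]_(x in M) phi x| <= K.
Proof.
move=> Mm mphi phiK.
apply: (le_trans (ler_norm_Rintegral mM mphi (finite_measure_integrable_cst m K mM) phiK)).
by rewrite Rintegral_cst// [X in fine X](Mm : _ = _) mulr1.
Qed.



(* Divide the defining identity between [m] and [mixture eps m (dirac x)] by
   [eps]: the left-hand side is independent of [eps] since [G] is affine, and
   on the right-hand side the base points tend weakly to [m] as [eps --> 0]. *)
Lemma flat_derivative_linear (g : E -> R) (G : P -> R) (D : P -> E -> R) (K C : R) :
  measurable_fun M g -> (forall x, M x -> `|g x| <= K) ->
  (forall m, probs M m -> G m = \int[m]_(x in M) g x) ->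
  is_flat_derivative M G D ->
  (forall m x, probs M m -> M x -> `|D m x| <= C) ->
  forall m x, probs M m -> M x -> D m x = g x - G m.
Proof.
move=> mg gK GE [cD _ hD nD] DC m x Mm Mx.
move/subspace_continuousP in cD.
pose ep k : R := k.+1%:R^-1.
have ep0 k : 0 < ep k by rewrite invr_gt0.
have ep01 k : 0 <= ep k <= 1 by rewrite ltW//= invf_le1// ler1n.
have Mdx := probs_dirac Mx.
pose mk k : P := mixture (ep k) m (dirac x : P).
have Mmk k : probs M (mk k) by exact: probs_mixture.
have Mmix e k : probs M (mixture e m (mk k)) by exact: probs_mixture.
have cvgm e : 0 <= e <= 1 -> (fun k => mixture e m (mk k) : P) @ \oo --> (m : weak_probs M).
  move=> e01; apply: cvg_weak_probs => phi K' mphi phiK'.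
  rewrite (_ : (fun _ => _) = (fun k => (1 - e) * \int[m]_(x in M) phi x +
    e * ((1 - ep k) * \int[m]_(x in M) phi x + ep k * phi x))); last first.
    apply/funext => k; rewrite (Rintegral_mixture e01 Mm (Mmk k) mphi phiK').
    by rewrite (Rintegral_mixture (ep01 k) Mm Mdx mphi phiK') (Rintegral_dirac Mx mphi).
  rewrite [X in _ --> X](_ : _ = (1 - e) * \int[m]_(x in M) phi x +
    e * ((1 - 0) * \int[m]_(x in M) phi x + 0 * phi x)); last by ring.
  apply: cvgD; first exact: cvg_cst.
  apply: cvgMr; apply: cvgD; apply: cvgMl; last exact: cvg_harmonic.
  by apply: cvgB; [exact: cvg_cst|exact: cvg_harmonic].
(* Joint continuity is only available within [probs M] and [M]; the mixtures stay there. *)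
have cvgD e z : 0 <= e <= 1 -> M z ->
    (fun k => D (mixture e m (mk k)) z) @ \oo --> D m z.
  move=> e01 Mz; apply: cvg_trans (cD (m, z) (conj Mm Mz)).
  have : (fun k => (mixture e m (mk k) : weak_probs M, z)) @ \oo --> (m : weak_probs M, z).
    apply: (@cvg_pair _ _ _ \oo (nbhs (m : weak_probs M)) (nbhs z)).
      exact: cvgm.
    exact: cvg_cst.
  move=> h B /h; rewrite !nbhs_filterE /=; apply: filterS => k kB; apply: kB; split; first exact: Mmix.
  exact: Mz.
have mD m0 : probs M m0 -> measurable_fun M (D m0).
  move=> Mm0; apply: within_continuous_measurable_rV; apply/subspace_continuousP => w Mw.
  apply: cvg_trans (cD (m0, w) (conj Mm0 Mw)).
  have : (fun w' => (m0 : weak_probs M, w')) @ (nbhs w) --> (m0 : weak_probs M, w).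
    apply: (@cvg_pair _ _ _ (nbhs w) (nbhs (m0 : weak_probs M)) (nbhs w)).
      exact: cvg_cst.
    exact: cvg_id.
  move=> h B /h; rewrite !nbhs_filterE /=; apply: filterS => w' wB Mw'; exact: wB.
(* As a signed measure, [mk k - m] is [ep k] times [dirac x - m]; hence the integrand of the
   defining identity has the exact factor [ep k], and [kf] is the quotient. *)
pose kf k e := D (mixture e m (mk k)) x - \int[m]_(z in M) D (mixture e m (mk k)) z.
have hE k e : \int[mk k]_(z in M) D (mixture e m (mk k)) z
    - \int[m]_(z in M) D (mixture e m (mk k)) z = ep k * kf k e.
  have mDe := mD _ (Mmix e k).
  have DCe z : M z -> `|D (mixture e m (mk k)) z| <= C by exact: DC.
  rewrite (Rintegral_mixture (ep01 k) Mm Mdx mDe DCe) (Rintegral_dirac Mx mDe).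
  by rewrite /kf; ring.
have ikf k : lebesgue_measure.-integrable `[0, 1] (EFin \o kf k).
  have [+ _] := hD m (mk k) Mm (Mmk k).
  move=> /(integrableZR _ (ep k)^-1) -/(_ (measurable_itv _)).
  apply: eq_integrable => //.
  by move=> e _ /=; rewrite hE mulrA mulVf ?mul1r// gt_eqF.
have kfE k : \int[lebesgue_measure]_(e in `[0, 1]) kf k e = g x - G m.
  have /= [_] := hD m (mk k) Mm (Mmk k).
  rewrite (_ : Rintegral _ _ _ = \int[lebesgue_measure]_(e in `[0, 1]) (ep k * kf k e)).
    2: by apply: eq_Rintegral => e _; exact: hE.
  rewrite RintegralZl// !GE// (Rintegral_mixture (ep01 k) Mm Mdx mg gK) (Rintegral_dirac Mx mg).
  move=> h; apply: (mulfI (lt0r_neq0 (ep0 k))); rewrite -h; ring.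
have l01 : lebesgue_measure (`[0, 1]%classic : set R) = 1%E.
  by rewrite lebesgue_measure_itv/= lte01 oppr0 adde0.
(* The limit passes under both integrals by bounded convergence, with constants [C] and [C + C].
   Normalization of [D m] removes the subtracted term. *)
have cvgk : (fun k => \int[lebesgue_measure]_(e in `[0, 1]) kf k e) @ \oo -->
    \int[lebesgue_measure]_(e in `[0%R, 1%R]) (D m x : R).
  apply: (bounded_convergence (C := C + C)) => //.
  - by rewrite [X in (X < _)%E](l01 : _ = _) ltry.
  - by move=> k; apply/measurable_EFinP; exact: measurable_int (ikf k).
  - move=> e /=; rewrite in_itv/= => e01.
    rewrite -[X in _ --> X]subr0 -(nD m Mm); apply: cvgB; first exact: cvgD.
    apply: (bounded_convergence (C := C)) => //.
    + by rewrite [X in (X < _)%E](Mm : _ = _) ltry.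
    + by move=> k; exact: mD.
    + exact: mD.
    + by move=> z Mz; exact: cvgD.
    + by move=> k z Mz; exact: DC.
  - move=> k e _; rewrite (le_trans (ler_normB _ _))// lerD ?DC//.
    by apply: Rintegral_bound => //; [exact: mD|move=> z Mz; exact: DC].
move: cvgk; rewrite (_ : (fun _ => _) = cst (g x - G m)); last exact/funext.
rewrite Rintegral_cst// [X in fine X](l01 : _ = _) mulr1.
move=> cvgk; have := cvg_lim (@Rhausdorff R) cvgk.
by rewrite (cvg_lim (@Rhausdorff R) (@cvg_cst _ _ _ _ _)) => ->.
Qed.

End flat_derivative_linear.

(** * The best response dynamics *)

Section one_sided_ode.
Context {R : realType}.
Implicit Types (u w : R -> R) (a b l r s t alpha : R).

Lemma is_derive_ge0P u r l : is_derive_ge0 u r l -> forall e, 0 < e ->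
  exists2 c, 0 < c & forall s, 0 <= s -> s != r -> `|r - s| < c ->
    `|l - (u s - u r) / (s - r)| < e.
Proof.
move=> /cvgrPdist_lt ul e /ul; rewrite /within/= near_withinE => /nbhs_ballP[c c0 H].
exists c => // s s0 sr rs; apply: H => //=.
by rewrite in_itv/= s0.
Qed.

Lemma is_derive_ge0_derive u r l : 0 < r -> is_derive_ge0 u r l ->
  is_derive r 1 u l.
Proof.
move=> r0 /is_derive_ge0P ul.
have cv : (fun h => h^-1 *: (u (h *: 1 + r) - u r)) @ 0^' --> l.
  apply/cvgrPdist_lt => e /ul[c c0 H]; near=> h.
  have h0 : h != 0 by near: h; exact: nbhs_dnbhs_neq.
  (* The bound by [r] keeps [h + r] in the half-line where the quotient is controlled. *)
  have hc : `|h| < Num.min c r.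
    near: h; apply: dnbhs0_lt; by rewrite lt_min c0.
  move: hc; rewrite lt_min => /andP[hc hr].
  have := H (h + r); rewrite addrK opprD addrCA subrr addr0 normrN => {}H.
  rewrite [h *: 1]mulr1 [_ *: _]mulrC; apply: H => //.
    by move: hr; rewrite ltr_norml => /andP[]; lra.
  by rewrite -subr_eq0 addrK.
by apply: DeriveDef; [apply/cvg_ex; exists l|exact/cvg_lim].
Unshelve. all: by end_near. Qed.

(** Includes [r = 0], where the derivative is one-sided: the monotonicity argument below needs
    continuity up to the endpoints. *)
Lemma is_derive_ge0_continuous u r l (D : set R) :
  (forall s, D s -> 0 <= s) -> is_derive_ge0 u r l ->
  u @ within D (nbhs r) --> u r.
Proof.
move=> D0 /is_derive_ge0P/(_ 1 ltr01)[c c0 H].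
apply/cvgrPdist_lt => e e0; rewrite near_withinE.
have K0 : 0 < `|l| + 1 by rewrite ltr_wpDl.
near=> s => Ds; have [->|sr] := eqVneq s r; first by rewrite subrr normr0.
have rs : `|r - s| < Num.min c (e / (`|l| + 1)).
  near: s; apply/nbhs_ballP; exists (Num.min c (e / (`|l| + 1))) => //=.
  by rewrite lt_min c0 divr_gt0.
move: rs; rewrite lt_min => /andP[rs re].
have {}H := H s (D0 _ Ds) sr rs.
have qK : `|(u s - u r) / (s - r)| <= `|l| + 1.
  have := ler_distD l 0 ((u s - u r) / (s - r)).
  rewrite !sub0r !normrN => h; apply: (le_trans h); rewrite lerD2l; exact: ltW.
rewrite distrC -[u s - u r](@divfK _ (s - r)) ?subr_eq0// normrM [X in _ * X]distrC.
rewrite (le_lt_trans (ler_wpM2r (normr_ge0 _) qK))// mulrC.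
by rewrite -ltr_pdivlMr.
Unshelve. all: by end_near. Qed.

(** With the integrating factor, [exp (alpha r) (u r - b)] has nonpositive derivative inside the
    interval. The forcing [w] is never integrated, so it needs no regularity in time. *)
Lemma relaxation_upper alpha u w s t b : 0 < alpha -> 0 <= s -> s <= t ->
  (forall r, s <= r <= t -> is_derive_ge0 u r (alpha * (w r - u r))) ->
  (forall r, s <= r <= t -> w r <= b) ->
  u t <= expR (- (alpha * (t - s))) * u s + (1 - expR (- (alpha * (t - s)))) * b.
Proof.
move=> a0 s0 st du wb.
pose phi r := expR (alpha * r) * (u r - b).
have dphi r : r \in `]s, t[ -> is_derive r 1 phi
    (expR (alpha * r) * (alpha * (w r - u r)) + (u r - b) * (expR (alpha * r) * alpha)).
  rewrite in_itv/= => /andP[sr rt].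
  have r0 : 0 < r by exact: le_lt_trans sr.
  have du' := is_derive_ge0_derive r0 (du r _); rewrite (ltW sr) (ltW rt) in du'.
  have {}du' := du' isT.
  have de : is_derive r 1 (fun r => expR (alpha * r)) (expR (alpha * r) * alpha).
    have di : is_derive r 1 (fun r => alpha * r) alpha.
      by apply: is_derive_eq; rewrite /GRing.scale/= mulr1.
    exact: (is_derive1_comp (f := expR)).
  have dub : is_derive r 1 (fun r => u r - b) (alpha * (w r - u r)).
    by apply: is_derive_eq; rewrite subr0.
  exact: (is_deriveM de dub).
have : phi t <= phi s.
  apply: (ler0_derive1_le_cc (a := s) (b := t)) => //.
  - by move=> r /dphi[].
  - move=> r rst; have dr := dphi r rst; rewrite derive1E derive_val.
    have := wb r; move: rst; rewrite in_itv/= => /andP[/ltW -> /ltW ->] /(_ isT) wrb.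
    rewrite [leLHS](_ : _ = alpha * expR (alpha * r) * (w r - b)); last by ring.
    by rewrite mulr_ge0_le0 ?subr_le0// mulr_ge0 ?expR_ge0// ltW.
  - apply/subspace_continuousP => r /=; rewrite in_itv/= => rst.
    apply: cvgM; last first.
      apply: cvgB; last exact: cvg_cst.
      apply: is_derive_ge0_continuous (du _ rst) => z /=; rewrite in_itv/= => /andP[+ _].
      exact: le_trans.
    apply: cvg_within_filter.
    by apply: (continuous_comp (f := fun z => alpha * z)); [exact: mulrl_continuous|exact: continuous_expR].
  - by rewrite in_itv/= lexx st.
  - by rewrite in_itv/= lexx st.
rewrite /phi -(ler_pM2l (expR_gt0 (- (alpha * t)))) !mulrA -!expRD addNr expR0 mul1r.
rewrite (_ : - (alpha * t) + alpha * s = - (alpha * (t - s))); last by ring.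
lra.
Qed.

Lemma is_derive_ge0N alpha u w r : is_derive_ge0 u r (alpha * (w r - u r)) ->
  is_derive_ge0 (fun r => - u r) r (alpha * (- w r - - u r)).
Proof.
rewrite -opprD mulrN => du.
rewrite /is_derive_ge0 (_ : (fun s => _) = (fun s => - ((u s - u r) / (s - r)))).
  exact: cvgN.
by apply/funext => s; rewrite -opprD mulNr.
Qed.

Lemma relaxation_lower alpha u w s t a : 0 < alpha -> 0 <= s -> s <= t ->
  (forall r, s <= r <= t -> is_derive_ge0 u r (alpha * (w r - u r))) ->
  (forall r, s <= r <= t -> a <= w r) ->
  expR (- (alpha * (t - s))) * u s + (1 - expR (- (alpha * (t - s)))) * a <= u t.
Proof.
move=> a0 s0 st du wa.
have du' r : s <= r <= t -> is_derive_ge0 (fun r => - u r) r (alpha * (- w r - - u r)).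
  by move=> rst; exact: is_derive_ge0N (du r rst).
have wa' r : s <= r <= t -> - w r <= - a by move=> rst; rewrite lerN2 wa.
have := relaxation_upper a0 s0 st du' wa'; lra.
Qed.

End one_sided_ode.

(** * One player along the flow *)

Section best_response_player.
Context {R : realType} {n : nat}.
Local Notation E := 'rV[R]_n.
Local Notation P := (probability E R).
Local Notation L := (lebesgue_rV R n).

Lemma decay_weight (alpha s t : R) : 0 < alpha -> s <= t ->
  0 <= 1 - expR (- (alpha * (t - s))) <= alpha * (t - s).
Proof.
move=> a0 st; apply/andP; split.
  by rewrite subr_ge0 expR_le1 oppr_le0 mulr_ge0 ?subr_ge0// ltW.
have := expR_ge1Dx (- (alpha * (t - s))); lra.
Qed.

Variables (X : set E) (q : E -> R).
Hypothesis mX : measurable X.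
Hypothesis mq : measurable_fun X q.
Hypothesis q_gt0 : forall x, X x -> 0 < q x.
Hypothesis q_int1 : (\int[L]_(x in X) (q x)%:E = 1)%E.
Variables (alpha k : R).
Hypotheses (alpha0 : 0 < alpha) (k0 : 0 <= k).
Local Notation gibbs := (gibbs L X q).
Local Notation Z := (partition_function L X q).

(* The field [G t] is [2 / sigma ^ 2] times the integral of [f] or [- f] against
   the measure played by the opponent at time [t]. *)
Record best_response_player (nu : R -> P) (p G : R -> E -> R) : Prop := {
  player_probs : forall t, 0 <= t -> probs X (nu t);
  player_density : forall t, 0 <= t -> is_density X (nu t) (p t);
  player_measurable : forall t, 0 <= t -> measurable_fun X (G t);
  player_bound : forall t x, 0 <= t -> X x -> `|G t x| <= k;
  player_ode : forall t x, 0 <= t -> X x ->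
    is_derive_ge0 (p^~ x) t (alpha * (gibbs (G t) x - p t x)) }.

Variables (nu : R -> P) (p G : R -> E -> R).
Hypothesis player : best_response_player nu p G.

Let density_ge0 t x : 0 <= t -> X x -> 0 <= p t x.
Proof. by move=> t0; have [_ + _] := player_density player t0; exact. Qed.

Let measurable_density t : 0 <= t -> measurable_fun X (p t).
Proof. by move=> t0; have [+ _ _] := player_density player t0. Qed.

Let integrable_density t : 0 <= t -> L.-integrable X (EFin \o p t).
Proof.
move=> t0.
exact: (is_density_integrable mX (player_probs player t0) (player_density player t0)).
Qed.

Let Rintegral_density t : 0 <= t -> \int[L]_(x in X) p t x = 1.
Proof.
move=> t0; rewrite /Rintegral.
by rewrite (is_density_integral1 mX (player_probs player t0) (player_density player t0)).
Qed.

Let iq : L.-integrable X (EFin \o q).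
Proof. by apply: integrable_unit_mass => // x Xx; exact: ltW (q_gt0 Xx). Qed.

Let q1 : \int[L]_(x in X) q x = 1. Proof. by rewrite /Rintegral q_int1. Qed.

Section time_step.
Variables s t : R.
Hypotheses (s0 : 0 <= s) (st : s <= t).
Let c := 1 - expR (- (alpha * (t - s))).
Let t0 : 0 <= t := le_trans s0 st.
Let c_ge0 : 0 <= c. Proof. by case/andP: (decay_weight alpha0 st). Qed.
Let c_le : c <= alpha * (t - s). Proof. by case/andP: (decay_weight alpha0 st). Qed.
Let cE : 1 - c = expR (- (alpha * (t - s))). Proof. by rewrite /c opprB addrC subrK. Qed.

Let ge0_of r : s <= r <= t -> 0 <= r.
Proof. by case/andP => + _; exact: le_trans. Qed.

(** Relies only on the uniform bounds of the Gibbs densities, not on any continuity of the field in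
    time; that continuity is deduced from it. *)
Lemma player_crude_step x : X x ->
  (1 - c) * p s x + c * (expR (- (k *+ 2)) * q x) <= p t x <=
  (1 - c) * p s x + c * (expR (k *+ 2) * q x).
Proof.
move=> Xx.
have gb r : s <= r <= t -> expR (- (k *+ 2)) * q x <= gibbs (G r) x <= expR (k *+ 2) * q x.
  move=> /ge0_of r0; apply: gibbs_bound => //; first exact: (player_measurable player r0).
  by move=> z; exact: (player_bound player r0).
have ode r : s <= r <= t -> is_derive_ge0 (p^~ x) r (alpha * (gibbs (G r) x - p r x)).
  by move=> /ge0_of r0; exact: (player_ode player r0 Xx).
rewrite cE /c; apply/andP; split.
  by apply: (relaxation_lower alpha0 s0 st ode) => r /gb/andP[].
by apply: (relaxation_upper alpha0 s0 st ode) => r /gb/andP[].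
Qed.

(** The target is frozen at the final time [t], as required by the variational argument in
    [player_step]; [gibbs_lipschitz] bounds the deviation of the moving target. *)
Lemma player_fine_step e : (forall r x, s <= r <= t -> X x -> `|G r x - G t x| <= e) ->
  forall x, X x ->
  `|p t x - (1 - c) * p s x - c * gibbs (G t) x| <= c * (4 * expR (k *+ 8) * e * q x).
Proof.
move=> Ge x Xx; set d := 4 * _ * _ * _.
have gd r : s <= r <= t -> `|gibbs (G r) x - gibbs (G t) x| <= d.
  move=> srt; have r0 := ge0_of srt; apply: gibbs_lipschitz => //.
  - exact: (player_measurable player t0).
  - exact: (player_measurable player r0).
  - by move=> z; exact: (player_bound player t0).
  - by move=> z; exact: (player_bound player r0).
  - by move=> z; exact: Ge.
have ode r : s <= r <= t -> is_derive_ge0 (p^~ x) r (alpha * (gibbs (G r) x - p r x)).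
  by move=> /ge0_of r0; exact: (player_ode player r0 Xx).
have := relaxation_upper alpha0 s0 st ode (b := gibbs (G t) x + d).
have := relaxation_lower alpha0 s0 st ode (a := gibbs (G t) x - d).
rewrite -/c -cE => lo up.
have {}lo : (1 - c) * p s x + c * (gibbs (G t) x - d) <= p t x.
  by apply: lo => r /gd; rewrite ler_distl => /andP[].
have {}up : p t x <= (1 - c) * p s x + c * (gibbs (G t) x + d).
  by apply: up => r /gd; rewrite ler_distl => /andP[].
by rewrite ler_norml; move: (gibbs _ _) lo up => g lo up; apply/andP; split; lra.
Qed.

(** By the crude step the density changes by at most [c (p s + exp (2 k) q)], of total mass
    [c (1 + exp (2 k))], and [c <= alpha (t - s)]. Applied to sections of the kernel, this controls
    the field felt by the opponent. *)
Lemma player_kernel_lipschitz (g : E -> R) : measurable_fun X g -> (forall x, X x -> `|g x| <= k) ->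
  `|\int[nu t]_(x in X) g x - \int[nu s]_(x in X) g x| <=
  alpha * (t - s) * (k * (1 + expR (k *+ 2))).
Proof.
move=> mg gk; rewrite !(Rintegral_is_density mX (player_density player _) mg gk)//.
have ipg r : 0 <= r -> L.-integrable X (EFin \o (fun x => p r x * g x)).
  move=> r0; apply: (le_integrableR mX _ (integrableZR mX k (integrable_density r0))).
    by apply: measurable_funM => //; exact: measurable_density.
  by move=> x Xx; rewrite normrM (ger0_norm (density_ge0 r0 Xx)) mulrC ler_wpM2r ?density_ge0 ?gk.
have ib := integrableDR mX (integrable_density s0) (integrableZR mX (expR (k *+ 2)) iq).
rewrite -RintegralB ?ipg//.
apply: (@le_trans _ _ (c * k * \int[L]_(x in X) (p s x + expR (k *+ 2) * q x))).
  rewrite -RintegralZl//; apply: ler_norm_Rintegral => //.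
  - apply: measurable_funB; apply: measurable_funM => //; exact: measurable_density.
  - exact: integrableZR.
  - move=> x Xx; rewrite -mulrBl normrM mulrC [c * k]mulrC -mulrA.
    apply: ler_pM => //; first exact: gk.
    have /andP[] := player_crude_step Xx.
    have := density_ge0 s0 Xx; have eq0 := q_gt0 Xx.
    have : 0 <= c * (expR (- (k *+ 2)) * q x) by rewrite mulr_ge0// mulr_ge0 ?expR_ge0// ltW.
    have : 0 <= c * (expR (k *+ 2) * q x) by rewrite mulr_ge0// mulr_ge0 ?expR_ge0// ltW.
    have : 0 <= c * p s x by rewrite mulr_ge0// density_ge0.
    by rewrite ler_norml => *; apply/andP; split; lra.
rewrite RintegralD ?RintegralZl ?Rintegral_density ?q1 ?mulr1//; last 2 first.
- exact: integrable_density.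
- exact: integrableZR.
rewrite -mulrA ler_wpM2r// mulr_ge0// addr_ge0// expR_ge0.
Qed.

Lemma player_kernel_step (g : E -> R) e (gam : P) : measurable_fun X g ->
  (forall x, X x -> `|g x| <= k) ->
  probs X gam -> is_density X gam (gibbs (G t)) ->
  (forall x, X x -> `|p t x - (1 - c) * p s x - c * gibbs (G t) x| <= c * (e * q x)) ->
  `|\int[nu t]_(x in X) g x - (1 - c) * \int[nu s]_(x in X) g x
    - c * \int[gam]_(x in X) g x| <= c * (k * e).
Proof.
move=> mg gk Xgam dgam step.
rewrite !(Rintegral_is_density mX (player_density player _) mg gk)//.
rewrite (Rintegral_is_density mX dgam mg gk).
have mr : measurable_fun X (gibbs (G t)) by case: dgam.
have r_ge0 x : X x -> 0 <= gibbs (G t) x by case: dgam => _ + _; exact.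
have ir := is_density_integrable mX Xgam dgam.
have ipg r : 0 <= r -> L.-integrable X (EFin \o (fun x => p r x * g x)).
  move=> r0; apply: (le_integrableR mX _ (integrableZR mX k (integrable_density r0))).
    by apply: measurable_funM => //; exact: measurable_density.
  by move=> x Xx; rewrite normrM (ger0_norm (density_ge0 r0 Xx)) mulrC ler_wpM2r ?density_ge0 ?gk.
have irg : L.-integrable X (EFin \o (fun x => gibbs (G t) x * g x)).
  apply: (le_integrableR mX _ (integrableZR mX k ir)); first exact: measurable_funM.
  by move=> x Xx; rewrite normrM (ger0_norm (r_ge0 _ Xx)) mulrC ler_wpM2r ?r_ge0 ?gk.
rewrite (_ : _ - _ - _ = \int[L]_(x in X) (1 * (p t x * g x)
    + - (1 - c) * (p s x * g x) + - c * (gibbs (G t) x * g x))); last first.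
  by rewrite Rintegral_lin3 ?ipg//; ring.
rewrite (_ : c * (k * e) = \int[L]_(x in X) (c * (k * e) * q x)); last first.
  by rewrite RintegralZl// q1 mulr1.
apply: ler_norm_Rintegral => //.
- apply/measurable_EFinP.
  exact: measurable_int (integrable_lin3 mX 1 (- (1 - c)) (- c) (ipg _ t0) (ipg _ s0) irg).
- exact: integrableZR.
- move=> x Xx.
  rewrite (_ : _ + _ + _ = (p t x - (1 - c) * p s x - c * gibbs (G t) x) * g x); last by ring.
  rewrite normrM (_ : c * _ * _ = c * (e * q x) * k); last by ring.
  by apply: ler_pM => //; [exact: step|exact: gk].
Qed.

Lemma player_free_energy_step (H : E -> R) e : s < t -> measurable_fun X H ->
  (forall x, X x -> `|H x| <= k) ->
  L.-integrable X (EFin \o entropy_integrand q (p s)) ->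
  (forall x, X x -> `|p t x - (1 - c) * p s x - c * gibbs (G t) x| <= c * (e * q x)) ->
  (forall x, X x -> `|G t x - (1 - c) * G s x - c * H x| <= c * e) ->
  L.-integrable X (EFin \o entropy_integrand q (p t)) /\
  \int[L]_(x in X) entropy_integrand q (p t) x + ln (Z (G t)) <=
  (1 - c) * (\int[L]_(x in X) entropy_integrand q (p s) x + ln (Z (G s)))
  + c * \int[L]_(x in X) (gibbs (G t) x * H x) + c * ((2 + k *+ 2) * e).
Proof.
move=> lt_st mH Hk ip pstep Gstep.
have c01 : 0 < c <= 1 by rewrite subr_gt0 expR_lt1 oppr_lt0 mulr_gt0 ?subr_gt0// gerBl expR_ge0.
apply: player_step => //.
- exact: measurable_density.
- exact: measurable_density.
- exact: (player_measurable player s0).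
- exact: (player_measurable player t0).
- by move=> x; exact: density_ge0.
- by move=> x; exact: (player_bound player s0).
- by move=> x; exact: (player_bound player t0).
- by move=> x; exact: player_crude_step.
Qed.

End time_step.
End best_response_player.

Section bounded_Rintegral.
Context d (T : measurableType d) (R : realType).
Variables (m : probability T R) (D : set T) (g : T -> R) (K : R).
Hypotheses (mD : measurable D) (mg : measurable_fun D g).
Hypothesis gK : forall x, D x -> `|g x| <= K.

Lemma Rintegral_probabilityZl (c : R) :
  \int[m]_(x in D) (c * g x) = c * \int[m]_(x in D) g x.
Proof.
rewrite RintegralZl//.
exact: (le_integrableR mD mg (finite_measure_integrable_cst m K mD)).
Qed.

End bounded_Rintegral.

(** * Coupling of the two players *)

Section two_players.
Context {R : realType} {n : nat}.
Local Notation E := 'rV[R]_n.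
Local Notation P := (probability E R).
Local Notation L := (lebesgue_rV R n).
Variables (X Y : set E) (qX qY : E -> R).
Hypotheses (mX : measurable X) (mY : measurable Y).
Hypotheses (mqX : measurable_fun X qX) (mqY : measurable_fun Y qY).
Hypothesis qX_gt0 : forall x, X x -> 0 < qX x.
Hypothesis qY_gt0 : forall y, Y y -> 0 < qY y.
Hypothesis qX_int1 : (\int[L]_(x in X) (qX x)%:E = 1)%E.
Hypothesis qY_int1 : (\int[L]_(y in Y) (qY y)%:E = 1)%E.
Variables (alpha k : R).
Hypotheses (alpha0 : 0 < alpha) (k0 : 0 <= k).
Variables (kX kY : E -> E -> R).
Hypothesis mkX : measurable_fun (X `*` Y) (fun z => kX z.1 z.2).
Hypothesis kX_le : forall x y, X x -> Y y -> `|kX x y| <= k.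
Hypothesis kYE : forall x y, kY y x = - kX x y.
Variables (nu mu : R -> P) (p r : R -> E -> R).
Let GX t x := \int[mu t]_(y in Y) kX x y.
Let GY t y := \int[nu t]_(x in X) kY y x.
Hypothesis playerX : best_response_player X qX alpha k nu p GX.
Hypothesis playerY : best_response_player Y qY alpha k mu r GY.

(** When both entropies are finite this is [2 / sigma ^ 2] times the Nikaido-Isoda error, by [NI_le]
    and [NI_ge]. *)
Definition free_energy_gap t :=
  (\int[L]_(x in X) entropy_integrand qX (p t) x + ln (partition_function L X qX (GX t)))
  + (\int[L]_(y in Y) entropy_integrand qY (r t) y + ln (partition_function L Y qY (GY t))).

(** A divergent [Rintegral] takes the value 0, so the gap is meaningful only together with this
    condition. *)
Definition finite_entropies t :=
  L.-integrable X (EFin \o entropy_integrand qX (p t)) /\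
  L.-integrable Y (EFin \o entropy_integrand qY (r t)).

Let mkX1 x : X x -> measurable_fun Y (kX x).
Proof. by move=> Xx; exact: (measurable_kernel_section2 mX mY mkX Xx). Qed.

Let mkX2 y : Y y -> measurable_fun X (kX^~ y).
Proof. by move=> Yy; exact: (measurable_kernel_section1 mX mY mkX Yy). Qed.

Let mkY1 y : Y y -> measurable_fun X (kY y).
Proof.
move=> Yy; rewrite (_ : kY y = fun x => - kX x y); last by apply/funext.
by apply: measurableT_comp => //; exact: mkX2.
Qed.

Let kY_le y x : Y y -> X x -> `|kY y x| <= k.
Proof. by move=> Yy Xx; rewrite kYE normrN kX_le. Qed.

(** Product of the Lipschitz constant of the Gibbs densities in the field, the Lipschitz constant of
    the fields in time, and a factor [1 + k] covering both density and field errors. *)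
Let error_rate := 4 * expR (k *+ 8) * (alpha * (k * (1 + expR (k *+ 2)))) * (1 + k).

Lemma free_energy_gap_step s t : 0 <= s -> s < t -> finite_entropies s ->
  finite_entropies t /\
  free_energy_gap t <= expR (- (alpha * (t - s))) * free_energy_gap s +
    (1 - expR (- (alpha * (t - s)))) *
    ((2 + k *+ 2) * error_rate *+ 2 * (t - s)).
Proof.
move=> s0 lt_st [iXs iYs]; have st := ltW lt_st; have t0 := le_trans s0 st.
pose eta := alpha * (t - s) * (k * (1 + expR (k *+ 2))).
have eta_mono u : s <= u <= t ->
    alpha * (t - u) * (k * (1 + expR (k *+ 2))) <= eta.
  move=> /andP[su _]; rewrite ler_wpM2r// ?mulr_ge0 ?addr_ge0 ?expR_ge0//.
  by rewrite ler_pM2l// lerD2l lerN2.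
have GXlip u x : s <= u <= t -> X x -> `|GX u x - GX t x| <= eta.
  move=> /[dup] /eta_mono + /andP[su ut] Xx; apply: le_trans; rewrite distrC.
  apply: (player_kernel_lipschitz mY mqY qY_gt0 qY_int1 alpha0 k0 playerY _ ut) => //.
  - exact: le_trans su.
  - exact: mkX1.
  - by move=> y Yy; exact: kX_le.
have GYlip u y : s <= u <= t -> Y y -> `|GY u y - GY t y| <= eta.
  move=> /[dup] /eta_mono + /andP[su ut] Yy; apply: le_trans; rewrite distrC.
  apply: (player_kernel_lipschitz mX mqX qX_gt0 qX_int1 alpha0 k0 playerX _ ut) => //.
  - exact: le_trans su.
  - exact: mkY1.
  - by move=> x Xx; exact: kY_le.
have pstep := player_fine_step mX mqX qX_gt0 qX_int1 alpha0 playerX s0 st GXlip.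
have rstep := player_fine_step mY mqY qY_gt0 qY_int1 alpha0 playerY s0 st GYlip.
set c := 1 - expR _ in pstep rstep *; set e0 := 4 * _ * eta in pstep rstep.
have c0 : 0 <= c by case/andP: (decay_weight alpha0 st).
have e0_ge0 : 0 <= e0.
  have eta0 : 0 <= eta.
    apply: mulr_ge0; first by rewrite mulr_ge0 ?subr_ge0// ltW.
    by rewrite mulr_ge0// addr_ge0// expR_ge0.
  by rewrite mulr_ge0// mulr_ge0// expR_ge0.
(* A common error: [e0] is that of the densities, [k * e0] that of the fields obtained by
   integrating a kernel bounded by [k]. *)
pose e := e0 * (1 + k).
have e0e : e0 <= e by rewrite ler_peMr// lerDl.
have ke0e : k * e0 <= e by rewrite /e mulrDr mulr1 mulrC lerDr.
have [psi Xpsi dpsi] := gibbs_measure mX mqX qX_gt0 qX_int1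
  (player_measurable playerX t0) (fun x => player_bound playerX t0).
have [phi Yphi dphi] := gibbs_measure mY mqY qY_gt0 qY_int1
  (player_measurable playerY t0) (fun y => player_bound playerY t0).
pose HX x := \int[phi]_(y in Y) kX x y.
pose HY y := \int[psi]_(x in X) kY y x.
have mHX : measurable_fun X HX by exact: measurable_Rintegral_kernel2 mX mY mkX kX_le _.
have HYE y : Y y -> HY y = -1 * \int[psi]_(x in X) kX x y.
  move=> Yy; rewrite -(Rintegral_probabilityZl _ mX (mkX2 Yy) (fun x Xx => kX_le Xx Yy)).
  by apply: eq_Rintegral => x _; rewrite kYE mulN1r.
have HX_le x : X x -> `|HX x| <= k.
  by move=> Xx; apply: (Rintegral_bound mY Yphi (mkX1 Xx)) => y; exact: kX_le.
have HY_le y : Y y -> `|HY y| <= k.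
  by move=> Yy; apply: (Rintegral_bound mX Xpsi (mkY1 Yy)) => x; exact: kY_le.
have mkX' := measurable_kernel_swap mX mY mkX.
have mkint : measurable_fun Y (fun y => \int[psi]_(x in X) kX x y).
  exact: (measurable_Rintegral_kernel2 mY mX mkX' (fun y x Yy Xx => kX_le Xx Yy) psi).
have mHY : measurable_fun Y HY.
  apply: (eq_measurable_fun (fun y => -1 * \int[psi]_(x in X) kX x y)).
    by move=> y /[!inE] Yy; rewrite HYE.
  exact: measurable_funM.
(* By Fubini both terms are the double integral of the kernel against the two best responses, with
   opposite signs. *)
have cross : \int[L]_(x in X) (gibbs L X qX (GX t) x * HX x) +
    \int[L]_(y in Y) (gibbs L Y qY (GY t) y * HY y) = 0.
  rewrite -(Rintegral_is_density mX dpsi mHX HX_le) -(Rintegral_is_density mY dphi mHY HY_le).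
  rewrite (Fubini_bounded_kernel mX mY mkX kX_le psi phi).
  rewrite [X in _ + X](_ : _ = -1 * \int[phi]_(y in Y) \int[psi]_(x in X) kX x y).
    by rewrite mulN1r subrr.
  rewrite -(Rintegral_probabilityZl (K := k) _ mY mkint).
    by apply: eq_Rintegral => y /[!inE] Yy; exact: HYE.
  by move=> y Yy; apply: (Rintegral_bound mX Xpsi (mkX2 Yy)) => x Xx; exact: kX_le.
have GXstep x : X x -> `|GX t x - (1 - c) * GX s x - c * HX x| <= c * e.
  move=> Xx; apply: (@le_trans _ _ (c * (k * e0))); last by rewrite ler_wpM2l.
  exact: (player_kernel_step mY mqY qY_gt0 qY_int1 playerY s0 st (mkX1 Xx)
    (fun y Yy => kX_le Xx Yy) Yphi dphi rstep).
have GYstep y : Y y -> `|GY t y - (1 - c) * GY s y - c * HY y| <= c * e.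
  move=> Yy; apply: (@le_trans _ _ (c * (k * e0))); last by rewrite ler_wpM2l.
  exact: (player_kernel_step mX mqX qX_gt0 qX_int1 playerX s0 st (mkY1 Yy)
    (fun x Xx => kY_le Yy Xx) Xpsi dpsi pstep).
have [] := player_free_energy_step mX mqX qX_gt0 qX_int1 alpha0 k0 playerX s0 st lt_st
  mHX HX_le iXs (e := e) _ GXstep.
  move=> x Xx; apply: (le_trans (pstep x Xx)); rewrite ler_wpM2l// ler_wpM2r//.
  exact: ltW (qX_gt0 Xx).
move=> iXt gapX.
have [] := player_free_energy_step mY mqY qY_gt0 qY_int1 alpha0 k0 playerY s0 st lt_st
  mHY HY_le iYs (e := e) _ GYstep.
  move=> y Yy; apply: (le_trans (rstep y Yy)); rewrite ler_wpM2l// ler_wpM2r//.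
  exact: ltW (qY_gt0 Yy).
move=> iYt gapY; split; first by split.
have cE : 1 - c = expR (- (alpha * (t - s))) by rewrite /c opprB addrC subrK.
rewrite -cE; apply: (le_trans (lerD gapX gapY)).
have -> : (2 + k *+ 2) * error_rate *+ 2 * (t - s) = ((2 + k *+ 2) * e) *+ 2.
  by rewrite /error_rate /e /e0 /eta; ring.
move/eqP: cross; rewrite addr_eq0 => /eqP ->; rewrite /free_energy_gap -/c.
rewrite le_eqVlt; apply/orP; left; apply/eqP; ring.
Qed.

Lemma free_energy_gap_decay t : 0 <= t -> finite_entropies 0 ->
  finite_entropies t /\ free_energy_gap t <= expR (- (alpha * t)) * free_energy_gap 0.
Proof.
move=> t0 fin0.
have fin s : 0 <= s -> finite_entropies s.
  rewrite le_eqVlt => /predU1P[<-//|s0].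
  by have [] := free_energy_gap_step (lexx 0) s0 fin0.
split; first exact: fin.
apply: (relaxation_decay (C := (2 + k *+ 2) * error_rate *+ 2)) => // a b a0 ab _.
by have [] := free_energy_gap_step a0 ab (fin a a0).
Qed.

End two_players.

(** * The Nikaido-Isoda error *)

Section Nikaido_Isoda.
Context {R : realType} {n : nat}.
Local Notation E := 'rV[R]_n.
Local Notation P := (probability E R).
Local Notation L := (lebesgue_rV R n).
Variables (X Y : set E) (Upi Urho : E -> R) (sigma K : R) (f : E -> E -> R).
Hypotheses (mX : measurable X) (mY : measurable Y).
Hypotheses (mUpi : measurable_fun X Upi) (mUrho : measurable_fun Y Urho).
Hypothesis Upi1 : (\int[L]_(x in X) (expR (- Upi x))%:E)%E = 1%E.
Hypothesis Urho1 : (\int[L]_(y in Y) (expR (- Urho y))%:E)%E = 1%E.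
Hypothesis sigma0 : 0 < sigma.
Hypothesis mf : measurable_fun (X `*` Y) (fun z => f z.1 z.2).
Hypothesis fK : forall x y, X x -> Y y -> `|f x y| <= K.
Implicit Types (nu mu : P).

Local Notation qX := (fun x => expR (- Upi x)).
Local Notation qY := (fun y => expR (- Urho y)).
Local Notation tau := (sigma ^+ 2 / 2).
Local Notation F := (payoff X Y f).
Local Notation V := (V X Y Upi Urho sigma F).
Local Notation NI := (NI X Y Upi Urho sigma F).

(** The first player minimizes, hence the sign. Up to terms constant in space, the fields of these
    kernels are the exponents of [Psi] and [Phi] relative to the reference densities. *)
Definition kernelX x y := - (2 / sigma ^+ 2) * f x y.
Definition kernelY y x := 2 / sigma ^+ 2 * f x y.
Definition fieldX mu x := \int[mu]_(y in Y) kernelX x y.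
Definition fieldY nu y := \int[nu]_(x in X) kernelY y x.
Local Notation ZX mu := (partition_function L X qX (fieldX mu)).
Local Notation ZY nu := (partition_function L Y qY (fieldY nu)).
Local Notation k := (2 / sigma ^+ 2 * K).

Let tau0 : 0 < tau. Proof. by rewrite divr_gt0 ?exprn_gt0. Qed.
Let tauV : 0 < 2 / sigma ^+ 2. Proof. by rewrite divr_gt0 ?exprn_gt0. Qed.
Let tauVE : tau * (2 / sigma ^+ 2) = 1.
Proof. by field; rewrite gt_eqF. Qed.

Let mqX : measurable_fun X qX.
Proof. by do 2 apply: measurableT_comp => //. Qed.
Let mqY : measurable_fun Y qY.
Proof. by do 2 apply: measurableT_comp => //. Qed.
Let qX_gt0 x : X x -> 0 < qX x. Proof. by rewrite expR_gt0. Qed.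
Let qY_gt0 y : Y y -> 0 < qY y. Proof. by rewrite expR_gt0. Qed.

Let mf' : measurable_fun (Y `*` X) (fun z => f z.2 z.1).
Proof. exact: (measurable_kernel_swap mX mY mf). Qed.

Let mf1 x : X x -> measurable_fun Y (f x).
Proof. by move=> Xx; exact: (measurable_kernel_section2 mX mY mf Xx). Qed.

Let mf2 y : Y y -> measurable_fun X (f^~ y).
Proof. by move=> Yy; exact: (measurable_kernel_section1 mX mY mf Yy). Qed.

Lemma measurable_kernelX : measurable_fun (X `*` Y) (fun z => kernelX z.1 z.2).
Proof. exact: measurable_funM. Qed.

Lemma kernelX_le x y : X x -> Y y -> `|kernelX x y| <= k.
Proof.
by move=> Xx Yy; rewrite normrM normrN (gtr0_norm tauV) ler_pM2l// fK.
Qed.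

Lemma kernelYE x y : kernelY y x = - kernelX x y.
Proof. by rewrite /kernelX mulNr opprK. Qed.

Lemma fieldXE mu x : X x -> fieldX mu x = - (2 / sigma ^+ 2) * \int[mu]_(y in Y) f x y.
Proof.
by move=> Xx; exact: (Rintegral_probabilityZl mu mY (mf1 Xx) (fun y Yy => fK Xx Yy)).
Qed.

Lemma fieldYE nu y : Y y -> fieldY nu y = 2 / sigma ^+ 2 * \int[nu]_(x in X) f x y.
Proof.
by move=> Yy; exact: (Rintegral_probabilityZl nu mX (mf2 Yy) (fun x Xx => fK Xx Yy)).
Qed.

Let measurable_int2 mu : measurable_fun X (fun x => \int[mu]_(y in Y) f x y).
Proof. exact: (measurable_Rintegral_kernel2 mX mY mf fK mu). Qed.

Let measurable_int1 nu : measurable_fun Y (fun y => \int[nu]_(x in X) f x y).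
Proof. exact: (measurable_Rintegral_kernel2 mY mX mf' (fun y x Yy Xx => fK Xx Yy) nu). Qed.

Let int2_le mu x : probs Y mu -> X x -> `|\int[mu]_(y in Y) f x y| <= K.
Proof. by move=> Ymu Xx; apply: (Rintegral_bound mY Ymu (mf1 Xx)) => y; exact: fK. Qed.

Let int1_le nu y : probs X nu -> Y y -> `|\int[nu]_(x in X) f x y| <= K.
Proof. by move=> Xnu Yy; apply: (Rintegral_bound mX Xnu (mf2 Yy)) => x Xx; exact: fK. Qed.

Lemma measurable_fieldX mu : measurable_fun X (fieldX mu).
Proof.
apply: (eq_measurable_fun (fun x => - (2 / sigma ^+ 2) * \int[mu]_(y in Y) f x y)).
  by move=> x /[!inE] Xx; rewrite fieldXE.
exact: measurable_funM.
Qed.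

Lemma measurable_fieldY nu : measurable_fun Y (fieldY nu).
Proof.
apply: (eq_measurable_fun (fun y => 2 / sigma ^+ 2 * \int[nu]_(x in X) f x y)).
  by move=> y /[!inE] Yy; rewrite fieldYE.
exact: measurable_funM.
Qed.

Lemma fieldX_le mu x : probs Y mu -> X x -> `|fieldX mu x| <= k.
Proof.
by move=> Ymu Xx; rewrite fieldXE// normrM normrN (gtr0_norm tauV) ler_pM2l// int2_le.
Qed.

Lemma fieldY_le nu y : probs X nu -> Y y -> `|fieldY nu y| <= k.
Proof.
by move=> Xnu Yy; rewrite fieldYE// normrM (gtr0_norm tauV) ler_pM2l// int1_le.
Qed.

Lemma payoff_fieldY nu mu : probs X nu ->
  F nu mu = tau * \int[mu]_(y in Y) fieldY nu y.
Proof.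
move=> Xnu; have -> : \int[mu]_(y in Y) fieldY nu y =
    \int[mu]_(y in Y) (2 / sigma ^+ 2 * \int[nu]_(x in X) f x y).
  by apply: eq_Rintegral => y /[!inE] Yy; rewrite fieldYE.
rewrite (Rintegral_probabilityZl _ mY (measurable_int1 nu) (fun y => @int1_le nu y Xnu)).
by rewrite mulrA tauVE mul1r.
Qed.

Lemma payoff_Fubini nu mu : F nu mu = \int[nu]_(x in X) \int[mu]_(y in Y) f x y.
Proof. by rewrite (Fubini_bounded_kernel mX mY mf fK nu mu). Qed.

Lemma payoff_fieldX nu mu : probs Y mu ->
  F nu mu = - (tau * \int[nu]_(x in X) fieldX mu x).
Proof.
move=> Ymu; rewrite payoff_Fubini; have -> : \int[nu]_(x in X) fieldX mu x =
    \int[nu]_(x in X) (- (2 / sigma ^+ 2) * \int[mu]_(y in Y) f x y).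
  by apply: eq_Rintegral => x /[!inE] Xx; rewrite fieldXE.
rewrite (Rintegral_probabilityZl _ mX (measurable_int2 mu) (fun x => @int2_le mu x Ymu)).
by rewrite mulrA mulrN tauVE mulN1r opprK.
Qed.

Let KL_cases (D : set E) (q : E -> R) m : measurable D -> measurable_fun D q ->
  (forall x, D x -> 0 < q x) -> (\int[L]_(x in D) (q x)%:E = 1)%E -> probs D m ->
  KL D m q = +oo%E \/ exists a : R, KL D m q = a%:E.
Proof.
move=> mD mq q0 q1 Dm.
have [->|[p mp]] := KL_infinite_or_density mD mq Dm; first by left.
have [->|[_ ->]] := KL_pinfty_or_integrable mD mq q0 q1 Dm mp; first by left.
by right; eexists.
Qed.

(** With one argument fixed, [V] is a constant plus or minus [tau] times the functional of
    [gibbs_variational] in the other. Competitors of infinite entropy give [-oo] in the supremum and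
    [+oo] in the infimum, hence are harmless. *)
Lemma NI_le nu mu (a b : R) : probs X nu -> probs Y mu ->
  KL X nu qX = a%:E -> KL Y mu qY = b%:E ->
  (NI nu mu <= (tau * ((a + ln (ZX mu)) + (b + ln (ZY nu))))%:E)%E.
Proof.
move=> Xnu Ymu KLa KLb.
have sup_le : (ereal_sup [set V nu mu' | mu' in probs Y] <= (tau * (a + ln (ZY nu)))%:E)%E.
  apply: ge_ereal_sup => _ [mu' Ymu' <-]; rewrite /Defs.V KLa (payoff_fieldY _ Xnu).
  have := gibbs_variational mY mqY qY_gt0 Urho1 (measurable_fieldY nu)
    (fun y => @fieldY_le nu y Xnu) Ymu'.
  have [->|[b' ->]] := KL_cases mY mqY qY_gt0 Urho1 Ymu'.
    by move=> _; rewrite [(- +oo)%E]/= addeNy gt0_muleNy ?lte_fin// addeNy leNye.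
  rewrite -!EFinB -EFinM -EFinD !lee_fin => h.
  by rewrite -mulrDr ler_pM2l//; lra.
have inf_ge : ((- (tau * (b + ln (ZX mu))))%:E <= ereal_inf [set V nu' mu | nu' in probs X])%E.
  apply: le_ereal_inf_tmp => _ [nu' Xnu' <-]; rewrite /Defs.V KLb (payoff_fieldX _ Ymu).
  have := gibbs_variational mX mqX qX_gt0 Upi1 (measurable_fieldX mu)
    (fun x => @fieldX_le mu x Ymu) Xnu'.
  have [->|[a' ->]] := KL_cases mX mqX qX_gt0 Upi1 Xnu'.
    by move=> _; rewrite addye// gt0_muley ?lte_fin// addey// leey.
  rewrite -!EFinB -EFinM -EFinD !lee_fin => h.
  by rewrite -[X in _ <= X + _]mulrN -mulrDr -mulrN ler_pM2l//; lra.
apply: (le_trans (leeB sup_le inf_ge)).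
rewrite -EFinB lee_fin opprK; move: (ln _) (ln _) => u v.
by rewrite le_eqVlt; apply/orP; left; apply/eqP; ring.
Qed.

(** The best responses are admissible competitors and attain the variational bounds. Against them an
    infinite entropy of [nu] makes the first value [+oo], and one of [mu] makes the second [-oo];
    either would force [NI] to be [+oo]. *)
Lemma NI_ge nu mu : probs X nu -> probs Y mu -> (NI nu mu < +oo)%E ->
  exists a b : R, [/\ KL X nu qX = a%:E, KL Y mu qY = b%:E &
    ((tau * ((a + ln (ZX mu)) + (b + ln (ZY nu))))%:E <= NI nu mu)%E].
Proof.
move=> Xnu Ymu NIfin.
have [psi Xpsi dpsi] := gibbs_measure mX mqX qX_gt0 Upi1 (measurable_fieldX mu)
  (fun x => @fieldX_le mu x Ymu).
have [phi Yphi dphi] := gibbs_measure mY mqY qY_gt0 Urho1 (measurable_fieldY nu)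
  (fun y => @fieldY_le nu y Xnu).
have NIge : (V nu phi - V psi mu <= NI nu mu)%E.
  by apply: leeB; [apply: ereal_sup_ubound; exists phi|apply: ereal_inf_lbound; exists psi].
have VY : V nu phi = ((tau * \int[phi]_(y in Y) fieldY nu y)%:E + tau%:E *
    (KL X nu qX - (\int[phi]_(y in Y) fieldY nu y - ln (ZY nu))%:E))%E.
  rewrite /Defs.V (payoff_fieldY _ Xnu).
  by rewrite (KL_gibbs mY mqY qY_gt0 Urho1 (measurable_fieldY nu) (fun y => @fieldY_le nu y Xnu) Yphi dphi).
have VX : V psi mu = ((- (tau * \int[psi]_(x in X) fieldX mu x))%:E + tau%:E *
    ((\int[psi]_(x in X) fieldX mu x - ln (ZX mu))%:E - KL Y mu qY))%E.
  rewrite /Defs.V (payoff_fieldX _ Ymu).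
  by rewrite (KL_gibbs mX mqX qX_gt0 Upi1 (measurable_fieldX mu) (fun x => @fieldX_le mu x Ymu) Xpsi dpsi).
have [KLa|[a KLa]] := KL_cases mX mqX qX_gt0 Upi1 Xnu.
  move: (le_lt_trans NIge NIfin); rewrite VY VX KLa.
  have [->|[b ->]] := KL_cases mY mqY qY_gt0 Urho1 Ymu.
    by rewrite addye// addeNy gt0_muley ?lte_fin// gt0_muleNy ?lte_fin// addeNy addey.
  by rewrite addye// gt0_muley ?lte_fin// addey// -!EFinB -EFinM -EFinD addye.
have [KLb|[b KLb]] := KL_cases mY mqY qY_gt0 Urho1 Ymu.
  move: (le_lt_trans NIge NIfin); rewrite VY VX KLa KLb.
  by rewrite addeNy gt0_muleNy ?lte_fin// addeNy addey// -!EFinB -EFinM -EFinD.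
exists a, b; split => //; apply: le_trans NIge; rewrite VY VX KLa KLb.
rewrite -!EFinB lee_fin; move: (ln _) (ln _) (Rintegral _ _ _) (Rintegral _ _ _) => *.
by rewrite le_eqVlt; apply/orP; left; apply/eqP; ring.
Qed.

End Nikaido_Isoda.

(** Constants added to the exponent cancel in the normalization; this absorbs the constant by which
    a flat derivative differs from the potential. *)
Lemma gibbs_rescale d (T : measurableType d) (R : realType)
    (L : {measure set T -> \bar R}) (X : set T) (q G g : T -> R) (a : R) :
  measurable X -> L.-integrable X (EFin \o (fun x => expR (G x) * q x)) ->
  (forall x, X x -> g x = expR a * (expR (G x) * q x)) ->
  forall x, X x -> g x / \int[L]_(z in X) g z = gibbs L X q G x.
Proof.
move=> mX iw gE x Xx; rewrite gE// (@eq_Rintegral _ _ _ _ _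
  (fun z => expR a * (expR (G z) * q z))); last by move=> z /[!inE] Xz; exact: gE.
by rewrite RintegralZl// invfM mulrACA divff ?mul1r// gt_eqF// expR_gt0.
Qed.

Theorem corollary2p5 (R : realType) (d : nat)
  (X Y : set 'rV[R]_d) (mX : measurable X) (mY : measurable Y)
  (Upi Urho : 'rV[R]_d -> R)
  (mUpi : measurable_fun X Upi) (mUrho : measurable_fun Y Urho)
  (Upi1 : (\int[lebesgue_rV R d]_(x in X) (expR (- Upi x))%:E)%E = 1%E)
  (Urho1 : (\int[lebesgue_rV R d]_(y in Y) (expR (- Urho y))%:E)%E = 1%E)
  (sigma alpha : R) (sigma0 : 0 < sigma) (alpha0 : 0 < alpha)
  (f : 'rV[R]_d -> 'rV[R]_d -> R)
  (mf : measurable_fun (X `*` Y) (fun z => f z.1 z.2))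
  (bf : [bounded f z.1 z.2 | z in X `*` Y])
  (dFnu dFmu : probability 'rV[R]_d R -> probability 'rV[R]_d R ->
     'rV[R]_d -> R)
  (d2Fnunu d2Fmumu d2Fnumu d2Fmunu :
     probability 'rV[R]_d R -> probability 'rV[R]_d R ->
     'rV[R]_d -> 'rV[R]_d -> R)
  (dFnuP : forall mu, probs Y mu ->
     is_flat_derivative X (fun nu => payoff X Y f nu mu)
                          (fun nu x => dFnu nu mu x))
  (dFmuP : forall nu, probs X nu ->
     is_flat_derivative Y (fun mu => payoff X Y f nu mu)
                          (fun mu y => dFmu nu mu y))
  (d2FnunuP : forall mu x, probs Y mu -> X x ->
     is_flat_derivative X (fun nu => dFnu nu mu x)
                          (fun nu x' => d2Fnunu nu mu x x'))
  (d2FmumuP : forall nu y, probs X nu -> Y y ->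
     is_flat_derivative Y (fun mu => dFmu nu mu y)
                          (fun mu y' => d2Fmumu nu mu y y'))
  (d2FnumuP : forall mu y, probs Y mu -> Y y ->
     is_flat_derivative X (fun nu => dFmu nu mu y)
                          (fun nu x => d2Fnumu nu mu y x))
  (d2FmunuP : forall nu x, probs X nu -> X x ->
     is_flat_derivative Y (fun mu => dFnu nu mu x)
                          (fun mu y => d2Fmunu nu mu x y))
  (dFnu_bound : exists2 C : R, 0 < C & forall nu mu x,
     probs X nu -> probs Y mu -> X x -> `|dFnu nu mu x| <= C)
  (dFmu_bound : exists2 C : R, 0 < C & forall nu mu y,
     probs X nu -> probs Y mu -> Y y -> `|dFmu nu mu y| <= C)
  (d2Fnunu_bound : exists2 C : R, 0 < C & forall nu mu x x',
     probs X nu -> probs Y mu -> X x -> X x' -> `|d2Fnunu nu mu x x'| <= C)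
  (d2Fmumu_bound : exists2 C : R, 0 < C & forall nu mu y y',
     probs X nu -> probs Y mu -> Y y -> Y y' -> `|d2Fmumu nu mu y y'| <= C)
  (d2Fnumu_bound : exists2 C : R, 0 < C & forall nu mu y x,
     probs X nu -> probs Y mu -> Y y -> X x -> `|d2Fnumu nu mu y x| <= C)
  (d2Fmunu_bound : exists2 C : R, 0 < C & forall nu mu x y,
     probs X nu -> probs Y mu -> X x -> Y y -> `|d2Fmunu nu mu x y| <= C)
  (nu0 mu0 : probability 'rV[R]_d R)
  (nu0_ac : probs_ac X nu0) (mu0_ac : probs_ac Y mu0)
  (NI0 : (NI X Y Upi Urho sigma (payoff X Y f) nu0 mu0 < +oo)%E)
  (nu mu : R -> probability 'rV[R]_d R)
  (flow : is_MFBR_flow X Y Upi Urho sigma dFnu dFmu alpha nu0 mu0 nu mu)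
  (t : R) (t0 : 0 <= t) :
  (NI X Y Upi Urho sigma (payoff X Y f) (nu t) (mu t)
   <= (expR (- alpha * t))%:E
      * NI X Y Upi Urho sigma (payoff X Y f) nu0 mu0)%E.
Proof.
have [[nu0E mu0E] acs [p [r [dens odeX odeY]]]] := flow.
have [K fK] : exists K, forall x y, X x -> Y y -> `|f x y| <= K.
  have [K [_ HK]] := bf; exists (K + 1) => x y Xx Yy.
  by apply: (HK _ _ (x, y)) => //; rewrite ltrDl.
(* The absolute value guarantees a nonnegative bound for the fields even when [X] or [Y] offers no
   point to test. *)
have {fK} fK x y : X x -> Y y -> `|f x y| <= `|K|.
  by move=> Xx Yy; rewrite (le_trans (fK x y Xx Yy))// ler_norm.
have Xnu s : 0 <= s -> probs X (nu s) by move=> /acs[[]].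
have Ymu s : 0 <= s -> probs Y (mu s) by move=> /acs[_ []].
have tauV : 0 < 2 / sigma ^+ 2 by rewrite divr_gt0 ?exprn_gt0.
have k0 : 0 <= 2 / sigma ^+ 2 * `|K| by rewrite mulr_ge0// ltW.
pose qX x := expR (- Upi x); pose qY y := expR (- Urho y).
have mqX : measurable_fun X qX by do 2 apply: measurableT_comp => //.
have mqY : measurable_fun Y qY by do 2 apply: measurableT_comp => //.
have qX0 x : X x -> 0 < qX x by rewrite expR_gt0.
have qY0 y : Y y -> 0 < qY y by rewrite expR_gt0.
have mf' := measurable_kernel_swap mX mY mf.
have dFnuE n m x : probs X n -> probs Y m -> X x ->
    dFnu n m x = \int[m]_(y in Y) f x y - payoff X Y f n m.
  move=> Xn Ym Xx; have [C C0 HC] := dFnu_bound.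
  apply: (flat_derivative_linear (g := fun x => \int[m]_(y in Y) f x y) (K := `|K|) mX _ _ _
    (dFnuP m Ym) (C := C)) => //.
  - exact: (measurable_Rintegral_kernel2 mX mY mf fK m).
  - move=> z Xz; apply: (Rintegral_bound mY Ym) => [|y Yy]; last exact: fK Xz Yy.
    exact: (measurable_kernel_section2 mX mY mf Xz).
  - by move=> n' _; rewrite (Fubini_bounded_kernel mX mY mf fK n' m).
  - by move=> n' z Xn' Xz; exact: HC.
have dFmuE n m y : probs X n -> probs Y m -> Y y ->
    dFmu n m y = \int[n]_(x in X) f x y - payoff X Y f n m.
  move=> Xn Ym Yy; have [C C0 HC] := dFmu_bound.
  apply: (flat_derivative_linear (g := fun y => \int[n]_(x in X) f x y) (K := `|K|) mY _ _ _
    (dFmuP n Xn) (C := C)) => //.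
  - exact: (measurable_Rintegral_kernel2 mY mX mf' (fun y x Yy Xx => fK x y Xx Yy) n).
  - move=> z Yz; apply: (Rintegral_bound mX Xn) => [|x Xx]; last exact: fK Xx Yz.
    exact: (measurable_kernel_section1 mX mY mf Yz).
  - by move=> m' z Ym' Yz; exact: HC.
pose GX s := fieldX Y sigma f (mu s); pose GY s := fieldY X sigma f (nu s).
have PsiE s x : 0 <= s -> X x ->
    Psi X Upi sigma dFnu (nu s) (mu s) x = gibbs (lebesgue_rV R d) X qX (GX s) x.
  (* The normalized flat derivative is the potential minus the payoff, which fixes the constant
     [a]. *)
  move=> s0 Xx; apply: (gibbs_rescale (a := 2 / sigma ^+ 2 * payoff X Y f (nu s) (mu s))) => //.
    apply: (integrable_weight mX mqX qX0 Upi1 (measurable_fieldX _ mX mY mf fK _)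
      (k := 2 / sigma ^+ 2 * `|K|)) => z Xz.
    exact: (fieldX_le mX mY sigma0 mf fK (Ymu s s0) Xz).
  move=> z Xz; rewrite (dFnuE _ _ _ (Xnu s s0) (Ymu s s0) Xz) /GX.
  rewrite (fieldXE _ mX mY mf fK _ Xz) /qX -!expRD; congr expR; ring.
have PhiE s y : 0 <= s -> Y y ->
    Phi Y Urho sigma dFmu (nu s) (mu s) y = gibbs (lebesgue_rV R d) Y qY (GY s) y.
  move=> s0 Yy; apply: (gibbs_rescale (a := - (2 / sigma ^+ 2 * payoff X Y f (nu s) (mu s)))) => //.
    apply: (integrable_weight mY mqY qY0 Urho1 (measurable_fieldY _ mX mY mf fK _)
      (k := 2 / sigma ^+ 2 * `|K|)) => z Yz.
    exact: (fieldY_le mX mY sigma0 mf fK (Xnu s s0) Yz).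
  move=> z Yz; rewrite (dFmuE _ _ _ (Xnu s s0) (Ymu s s0) Yz) /GY.
  rewrite (fieldYE _ mX mY mf fK _ Yz) /qY -!expRD; congr expR; ring.
have playerX : best_response_player X qX alpha (2 / sigma ^+ 2 * `|K|) nu p GX.
  split => //.
  - by move=> s /dens[].
  - by move=> s s0; exact: (measurable_fieldX _ mX mY mf fK).
  - by move=> s x s0 Xx; exact: (fieldX_le mX mY sigma0 mf fK (Ymu s s0) Xx).
  - by move=> s x s0 Xx; rewrite -PsiE//; exact: odeX.
have playerY : best_response_player Y qY alpha (2 / sigma ^+ 2 * `|K|) mu r GY.
  split => //.
  - by move=> s /dens[].
  - by move=> s s0; exact: (measurable_fieldY _ mX mY mf fK).
  - by move=> s y s0 Yy; exact: (fieldY_le mX mY sigma0 mf fK (Xnu s s0) Yy).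
  - by move=> s y s0 Yy; rewrite -PhiE//; exact: odeY.
have X0 := Xnu 0 (lexx 0); have Y0 := Ymu 0 (lexx 0).
rewrite -nu0E -mu0E in NI0 *.
have [a [b [KLa KLb NIge]]] := NI_ge mX mY mUpi mUrho Upi1 Urho1 sigma0 mf fK X0 Y0 NI0.
(* The finite entropy at time 0 is rewritten with the representative [p 0] carried by the flow, for
   which the decay estimate is stated. *)
have [iX0 KLX0] : (lebesgue_rV R d).-integrable X (EFin \o entropy_integrand qX (p 0)) /\
    a = \int[lebesgue_rV R d]_(x in X) entropy_integrand qX (p 0) x.
  have [E|[i E]] := KL_pinfty_or_integrable mX mqX qX0 Upi1 X0 (dens 0 (lexx 0)).1.
    by rewrite E in KLa.
  by split => //; apply: EFin_inj; rewrite -KLa -E.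
have [iY0 KLY0] : (lebesgue_rV R d).-integrable Y (EFin \o entropy_integrand qY (r 0)) /\
    b = \int[lebesgue_rV R d]_(y in Y) entropy_integrand qY (r 0) y.
  have [E|[i E]] := KL_pinfty_or_integrable mY mqY qY0 Urho1 Y0 (dens 0 (lexx 0)).2.
    by rewrite E in KLb.
  by split => //; apply: EFin_inj; rewrite -KLb -E.
have [[iXt iYt] decay] := free_energy_gap_decay mX mY mqX mqY qX0 qY0 Upi1 Urho1 alpha0 k0
  (measurable_kernelX sigma mf) (kernelX_le sigma0 fK) (kernelYE sigma f)
  playerX playerY t0 (conj iX0 iY0).
have KLXt : KL X (nu t) qX = (\int[lebesgue_rV R d]_(x in X) entropy_integrand qX (p t) x)%:E.
  rewrite (KL_is_density mX mqX qX0 (dens t t0).1) /Rintegral fineK//.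
  exact: integrable_fin_num iXt.
have KLYt : KL Y (mu t) qY = (\int[lebesgue_rV R d]_(y in Y) entropy_integrand qY (r t) y)%:E.
  rewrite (KL_is_density mY mqY qY0 (dens t t0).2) /Rintegral fineK//.
  exact: integrable_fin_num iYt.
have NIle := NI_le mX mY mUpi mUrho Upi1 Urho1 sigma0 mf fK (Xnu t t0) (Ymu t t0) KLXt KLYt.
apply: (le_trans NIle).
(* The upper bound on [NI] is used at time [t] and the lower bound at time 0, with the decay of the
   gap in between. *)
apply: (le_trans _ (lee_wpmul2l _ NIge)); last by rewrite lee_fin expR_ge0.
rewrite -EFinM lee_fin KLX0 KLY0 mulrCA ler_pM2l ?divr_gt0 ?exprn_gt0// mulNr.
exact: decay.
Qed.
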